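(* Let $s>0$ and let $\kappa>0$ satisfy $36\kappa s^2\le 1$. Put $\sigma=3s^2$. Then there exists a smooth monotone traveling wave solution $u^S=u^S(\xi)$, $\xi=x-\sigma t$, of $u_t+(u^3)_x=u_{xx}-\kappa u_{xxx}$, i.e. a solution of $$-\sigma u^S_\xi+\big((u^S)^3\big)_\xi=u^S_{\xi\xi}-\kappa u^S_{\xi\xi\xi}\quad\text{on }\mathbb{R},\qquad u^S(-\infty)=-2s,\quad u^S(+\infty)=s .$$ The profile is unique up to translation. Normalized by $u^S(0)=0$, it satisfies $$(4\sqrt3-6)(u^S(\xi)-s)^2(u^S(\xi)+2s)\le u^S_\xi(\xi)\le 2(u^S(\xi)-s)^2(u^S(\xi)+2s),\qquad \forall\,\xi\in\mathbb{R},$$ which implies the decay properties $$2s\,e^{-18s^2|\xi|}\le u^S(\xi)+2s\le 2s\,e^{-(4\sqrt3-6)s^2|\xi|},\qquad \forall\,\xi<0,$$ $$\frac{s}{1+6s^2|\xi|}\le s-u^S(\xi)\le\frac{s}{1+2(4\sqrt3-6)s^2|\xi|},\qquad\forall\,\xi>0,$$ $$2(4\sqrt3-6)s^3e^{-18s^2|\xi|}\le u^S_\xi(\xi)\le 36s^3e^{-(4\sqrt3-6)s^2|\xi|},\qquad\forall\,\xi<0,$$ $$\frac{2(4\sqrt3-6)s^3}{(1+6s^2|\xi|)^2}\le u^S_\xi(\xi)\le\frac{6s^3}{(1+2(4\sqrt3-6)s^2|\xi|)^2},\qquad\forall\,\xi>0.$$ Moreover, for all $\xi\in\mathbb{R}$,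 $$-3s^2u^S_\xi\le u^S_{\xi\xi}\le 18s^2u^S_\xi,\qquad -60s^4u^S_\xi\le u^S_{\xi\xi\xi}\le 324s^4u^S_\xi,$$ which implies $|u^S_{\xi\xi}|\le 18s^2u^S_\xi$ and $|u^S_{\xi\xi\xi}|\le 324s^4u^S_\xi$.
   Context: The equation is the modified Korteweg--de Vries--Burgers equation with cubic flux, with viscosity coefficient $\mu$ normalized to $1$ and dispersion coefficient $\kappa>0$. ''Monotone'' means that the profile is monotonically increasing. *)

(* Defs.v *)
From Stdlib Require Import Reals.
From Coquelicot Require Import Coquelicot.
Open Scope R_scope.

(* [ex_derive_n u k x] alone only says that [Derive_n u (k - 1)], which is a
   total function, is differentiable at [x]; hence the quantification over
   every order up to the one required. *)
Definition smooth (u : R -> R) : Prop :=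
  forall (n : nat) (xi : R), ex_derive_n u n xi.

(* Classical (three times differentiable) profile of a traveling wave of speed
   [sigma] of u_t + (u^3)_x = u_xx - kappa u_xxx, joining [um] at -oo to [up]
   at +oo. *)
Definition wave_profile (kappa sigma um up : R) (u : R -> R) : Prop :=
  (forall (k : nat) (xi : R), (k <= 3)%nat -> ex_derive_n u k xi) /\
  (forall xi : R,
     - sigma * Derive u xi + Derive (fun y => u y ^ 3) xi
     = Derive_n u 2 xi - kappa * Derive_n u 3 xi) /\
  is_lim u m_infty um /\
  is_lim u p_infty up.

(* Main.v *)
(* Integrating once, a profile solves [v' = p], [kappa p' = p - F(v)] with
   [F(v) = (v - s)^2 (v + 2s)]: the integration constant vanishes at +oo. A
   quantity [d] with [k d' <= d], [k > 0], that is frequently bounded below near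
   +oo must be nonnegative, since a negative value would be amplified
   exponentially. Each pointwise estimate is obtained in this way from a suitable
   [d], for instance [2 F(v) - p] and [p - c F(v)]; the hypothesis
   [36 kappa s^2 <= 1] is what makes these barriers work, and together with the
   last crossing of the level [-2s] it confines every profile to (-2s, s).

   As a function of [x = s - v], the energy [y = p^2 / 2] solves
   [kappa y' = F(s - x) - sqrt (2 y)], [y(0) = 0]. Although the square root is
   not Lipschitz at 0 it is monotone, so approximate solutions stay close and
   converge to a solution on [0, 3s]. It gives the speed [p = P(v)] at each
   height, and [v] is the inverse of the travel time [Phi' = 1 / P]. Any profile
   satisfies [v' = P(v)], because [v' - P(v)] would otherwise be amplified while
   it tends to 0 at +oo; hence [Phi(v(x)) - x] is constant, which is uniqueness
   up to translation. *)

Require Import Defs.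
From Stdlib Require Import Reals Lra Lia Psatz.
From Coquelicot Require Import Coquelicot.
Open Scope R_scope.

(** * Mean value estimates, Gronwall arguments and inverse functions *)

Lemma mean_value (f df : R -> R) (a b : R) :
  a < b -> (forall x, a <= x <= b -> is_derive f x (df x)) ->
  exists c, a < c < b /\ f b - f a = df c * (b - a).
Proof.
  intros hab hf.
  destruct (MVT_cor2 f df a b hab) as [c [hc hc']].
  - intros c hc. apply is_derive_Reals, hf, hc.
  - exists c; split; assumption.
Qed.

Lemma derive_le_bound (f df : R -> R) (a b C : R) :
  a <= b -> (forall x, a <= x <= b -> is_derive f x (df x)) ->
  (forall x, a <= x <= b -> df x <= C) -> f b - f a <= C * (b - a).
Proof.
  intros [hab | <-] hf hC; [|lra].
  destruct (mean_value f df a b hab hf) as [c [hc ->]].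
  apply Rmult_le_compat_r; [lra | apply hC; lra].
Qed.

Lemma derive_abs_bound (f df : R -> R) (a b C : R) :
  a <= b -> (forall x, a <= x <= b -> is_derive f x (df x)) ->
  (forall x, a <= x <= b -> Rabs (df x) <= C) ->
  Rabs (f b - f a) <= C * (b - a).
Proof.
  intros hab hf hC.
  apply Rabs_le; split.
  - assert (h : - f b - - f a <= C * (b - a)).
    { apply (derive_le_bound (fun x => - f x) (fun x => - df x)); [lra | |].
      - intros x hx; apply (is_derive_opp f), hf, hx.
      - intros x hx; specialize (hC x hx); apply Rabs_le_between in hC; lra. }
    lra.
  - apply (derive_le_bound f df); [lra | assumption |].
    intros x hx; specialize (hC x hx); apply Rabs_le_between in hC; lra.
Qed.

Lemma is_derive_continuity_pt (f : R -> R) (x l : R) :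
  is_derive f x l -> continuity_pt f x.
Proof.
  intros h; apply derivable_continuous_pt; exists l.
  now apply is_derive_Reals.
Qed.

Lemma continuity_pt_nbhd (f : R -> R) (x eps : R) :
  continuity_pt f x -> 0 < eps ->
  exists d, 0 < d /\ forall y, Rabs (y - x) < d -> Rabs (f y - f x) < eps.
Proof.
  intros h heps.
  destruct (proj1 (continuity_pt_locally f x) h (mkposreal eps heps)) as [d hd].
  exists d; split; [apply cond_pos | exact hd].
Qed.

(** [m] is the supremum of the points of [a, b] where [f <= l]; continuity at [m] excludes both
    [f m > l] and [f m < l]. *)
Lemma last_crossing (f : R -> R) (a b l : R) :
  a <= b -> (forall x, a <= x <= b -> continuity_pt f x) ->
  f a <= l -> l < f b ->
  exists m, a <= m < b /\ f m = l /\ forall x, m < x <= b -> l < f x.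
Proof.
  intros hab hf ha hb.
  destruct (completeness (fun x => a <= x <= b /\ f x <= l)) as [m [hm1 hm2]].
  { exists b; intros x [hx _]; lra. }
  { exists a; lra. }
  assert (ham : a <= m) by (apply hm1; lra).
  assert (hmb : m <= b) by (apply hm2; intros x [hx _]; lra).
  assert (hfm := hf m (conj ham hmb)).
  assert (habove : forall x, m < x <= b -> l < f x).
  { intros x hx; apply Rnot_le_lt; intros hle.
    assert (x <= m) by (apply hm1; lra); lra. }
  assert (hle : f m <= l).
  { apply Rnot_lt_le; intros hlt.
    destruct (continuity_pt_nbhd f m (f m - l) hfm) as [d [hd hd']]; [lra|].
    assert (m <= m - d); [|lra].
    apply hm2; intros x [hx hfx]; apply Rnot_lt_le; intros hxd.
    assert (x <= m) by (apply hm1; lra).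
    specialize (hd' x ltac:(apply Rabs_def1; lra)).
    apply Rabs_def2 in hd'; lra. }
  assert (hmb' : m < b) by (destruct hmb as [h | ->]; lra).
  exists m; split; [lra|]; split; [|exact habove].
  apply Rle_antisym; [exact hle | apply Rnot_lt_le; intros hlt].
  destruct (continuity_pt_nbhd f m (l - f m) hfm) as [d [hd hd']]; [lra|].
  set (x := Rmin b (m + d / 2)).
  assert (hx : m < x <= b /\ x <= m + d / 2).
  { unfold x; split; [split|]; [apply Rmin_glb_lt; lra | apply Rmin_l | apply Rmin_r]. }
  specialize (hd' x ltac:(apply Rabs_def1; lra)).
  assert (h := habove x ltac:(lra)).
  apply Rabs_def2 in hd'; lra.
Qed.

(** After its last zero [D] would be positive, hence could not grow; so the sign of [dD] matters
    only where [D] is positive, which suits comparison arguments. *)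
Lemma nonpos_of_derive_nonpos (D dD : R -> R) (a b : R) :
  a <= b -> (forall x, a <= x <= b -> is_derive D x (dD x)) ->
  (forall x, a <= x <= b -> 0 < D x -> dD x <= 0) ->
  D a <= 0 -> D b <= 0.
Proof.
  intros hab hD hd ha; apply Rnot_lt_le; intros hb.
  destruct (last_crossing D a b 0 hab) as [m [hm [hm0 hm1]]]; try assumption.
  { intros x hx; apply (is_derive_continuity_pt D x (dD x)), hD, hx. }
  destruct (mean_value D dD m b) as [c [hc heq]]; [lra | intros; apply hD; lra |].
  assert (dD c <= 0) by (apply hd; [lra | apply hm1; lra]).
  nra.
Qed.

(** [z x * exp (- K x)] is nonincreasing. No sign is imposed on [z] or [K]: later uses take negative
    values of both. *)
Lemma gronwall (z dz : R -> R) (K a b : R) :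
  a <= b -> (forall x, a <= x <= b -> is_derive z x (dz x)) ->
  (forall x, a <= x <= b -> dz x <= K * z x) ->
  z b <= z a * exp (K * (b - a)).
Proof.
  intros hab hz hK.
  assert (h : z b * exp (- K * b) - z a * exp (- K * a) <= 0 * (b - a)).
  { apply (derive_le_bound (fun x => z x * exp (- K * x))
             (fun x => (dz x - K * z x) * exp (- K * x))); [assumption | |].
    - intros x hx.
      assert (h := hz x hx).
      auto_derive; [now exists (dz x)|].
      replace (Derive _ x) with (dz x) by (symmetry; apply is_derive_unique, h); ring.
    - intros x hx; specialize (hK x hx).
      assert (0 < exp (- K * x)) by apply exp_pos; nra. }
  assert (hb : z b = z b * exp (- K * b) * exp (K * b)).
  { rewrite Rmult_assoc, <- exp_plus; replace (- K * b + K * b) with 0 by ring.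
    rewrite exp_0; ring. }
  assert (ha : z a * exp (K * (b - a)) = z a * exp (- K * a) * exp (K * b)).
  { rewrite Rmult_assoc, <- exp_plus; do 2 f_equal; ring. }
  rewrite hb, ha.
  apply Rmult_le_compat_r; [left; apply exp_pos | lra].
Qed.

Lemma nonneg_of_backward_gronwall (d dd : R -> R) (k a B : R) :
  0 < k -> (forall x, a <= x -> is_derive d x (dd x)) ->
  (forall x, a <= x -> k * dd x <= d x) ->
  (forall X, exists x, X <= x /\ - B <= d x) ->
  0 <= d a.
Proof.
  intros hk hd hdd hB; apply Rnot_lt_le; intros hneg.
  (* Far enough for contradiction: [exp t >= 1 + t] then gives [d x <= d a - Rabs B < - B]. *)
  destruct (hB (a + k * (Rabs B / - d a))) as [x [hx hBx]].
  assert (hq : 0 <= Rabs B / - d a).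
  { apply Rmult_le_pos; [apply Rabs_pos | left; apply Rinv_0_lt_compat; lra]. }
  assert (hax : a <= x) by nra.
  assert (h : d x <= d a * exp (/ k * (x - a))).
  { apply gronwall with (dz := dd); [assumption | intros; apply hd; lra |].
    intros y hy; specialize (hdd y ltac:(lra)).
    apply Rmult_le_reg_l with k; [assumption|].
    rewrite <- Rmult_assoc, Rinv_r, Rmult_1_l; lra. }
  assert (he := exp_ineq1_le (/ k * (x - a))).
  assert (ht : Rabs B / - d a <= / k * (x - a)).
  { apply Rmult_le_reg_l with k; [assumption|].
    rewrite <- Rmult_assoc, Rinv_r, Rmult_1_l; lra. }
  assert (hB' : Rabs B = Rabs B / - d a * - d a) by (field; lra).
  assert (B <= Rabs B) by apply Rle_abs.
  nra.
Qed.

Lemma constant_of_derive_zero (f : R -> R) :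
  (forall x, is_derive f x 0) -> forall a b, f a = f b.
Proof.
  assert (h : (forall x, is_derive f x 0) -> forall a b, a < b -> f a = f b).
  { intros hf a b hab.
    destruct (mean_value f (fun _ => 0) a b hab) as [c [_ hc]]; [intros; apply hf | lra]. }
  intros hf a b; destruct (Rtotal_order a b) as [hab | [-> | hab]].
  - now apply h.
  - reflexivity.
  - symmetry; now apply h.
Qed.

Lemma is_derive_add_const (f : R -> R) (c x l : R) :
  is_derive f x l -> is_derive (fun t => f t + c) x l.
Proof.
  intros h; auto_derive; [now exists l|].
  rewrite Rmult_1_l; apply is_derive_unique, h.
Qed.

(** A slope of at least [m] makes [Z] expand distances by [m]. This gives injectivity, surjectivity
    by intermediate values, and an inverse with Lipschitz constant [/ m]. *)
Lemma inverse_of_expanding (Z z : R -> R) (m : R) :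
  0 < m -> (forall x, is_derive Z x (z x)) -> (forall x, m <= z x) ->
  exists Y : R -> R, (forall x, Y (Z x) = x) /\ (forall t, Z (Y t) = t) /\
    forall t, is_derive Y t (/ z (Y t)).
Proof.
  intros hm hZ hz.
  assert (hexp : forall a b, a <= b -> m * (b - a) <= Z b - Z a).
  { intros a b hab.
    assert (h : - Z b - - Z a <= - m * (b - a)); [|lra].
    apply (derive_le_bound (fun x => - Z x) (fun x => - z x)); [exact hab | |].
    - intros x _; apply (is_derive_opp Z), hZ.
    - intros x _; specialize (hz x); lra. }
  assert (hinj : forall a b, m * Rabs (b - a) <= Rabs (Z b - Z a)).
  { intros a b; destruct (Rle_dec a b) as [h | h].
    - specialize (hexp a b h); rewrite !Rabs_pos_eq; nra.
    - specialize (hexp b a ltac:(lra)).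
      rewrite (Rabs_minus_sym b), (Rabs_minus_sym (Z b)), !Rabs_pos_eq; nra. }
  assert (hcont : forall x, continuity_pt Z x).
  { intros x; eapply is_derive_continuity_pt, hZ. }
  assert (hsurj : forall t, {x | Z x = t}).
  { intros t.
    (* On [-r, r] the function moves by at least [m * r] to either side of [Z 0], so [t] is
       bracketed. *)
    set (r := Rabs (t - Z 0) / m).
    assert (hr : 0 <= r) by (apply Rle_mult_inv_pos; [apply Rabs_pos | exact hm]).
    assert (hrm : m * r = Rabs (t - Z 0)) by (unfold r; field; lra).
    assert (h1 := hexp 0 r hr); assert (h2 := hexp (- r) 0 ltac:(lra)).
    assert (h3 := Rabs_le_between (t - Z 0) (Rabs (t - Z 0))).
    assert (h4 := proj1 h3 (Rle_refl _)).
    destruct (IVT_gen Z (- r) r t) as [x [_ hx]]; [exact hcont | | now exists x].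
    rewrite Rmin_left, Rmax_right; lra. }
  set (Y := fun t => proj1_sig (hsurj t)).
  assert (hZY : forall t, Z (Y t) = t) by (intros t; apply (proj2_sig (hsurj t))).
  assert (hYZ : forall x, Y (Z x) = x).
  { intros x; specialize (hinj x (Y (Z x))); rewrite hZY, Rminus_diag, Rabs_R0 in hinj.
    apply Rminus_diag_uniq, Rabs_eq_0, Rle_antisym; [nra | apply Rabs_pos]. }
  exists Y; split; [exact hYZ|]; split; [exact hZY|]; intros t.
  set (x := Y t); assert (hzx := hz x).
  assert (hd := hZ x); apply is_derive_Reals in hd.
  apply is_derive_Reals; intros eps heps.
  (* The factor [z x] cancels the denominator of the inverse difference quotient, and [m] absorbs
     the ratio of [Rabs k] to [Rabs h]. *)
  assert (he : 0 < eps * (m * z x)) by (apply Rmult_lt_0_compat; nra).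
  destruct (hd _ he) as [r hr].
  assert (hmr : 0 < m * r) by (apply Rmult_lt_0_compat; [exact hm | apply cond_pos]).
  exists (mkposreal _ hmr); intros h hne hlt; simpl in hlt.
  set (k := Y (t + h) - x).
  assert (hk : Z (x + k) - Z x = h).
  { unfold k; replace (x + (Y (t + h) - x)) with (Y (t + h)) by ring.
    unfold x; rewrite !hZY; ring. }
  assert (hkh : m * Rabs k <= Rabs h).
  { specialize (hinj x (x + k)); rewrite hk in hinj.
    replace (x + k - x) with k in hinj by ring; exact hinj. }
  assert (hk0 : k <> 0).
  { intros h0; rewrite h0, Rplus_0_r in hk; lra. }
  specialize (hr k hk0 ltac:(nra)); rewrite hk in hr.
  fold x k.
  replace (k / h - / z x) with (- ((h / k - z x) * k / (h * z x))) by (field; lra).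
  rewrite Rabs_Ropp; unfold Rdiv; rewrite !Rabs_mult, Rabs_inv, Rabs_mult.
  rewrite (Rabs_pos_eq (z x)) by lra.
  assert (hh : 0 < Rabs h) by now apply Rabs_pos_lt.
  assert (hk' : 0 < Rabs k) by now apply Rabs_pos_lt.
  apply (Rlt_div_l _ _ (Rabs h * z x)); [apply Rmult_lt_0_compat; lra|].
  apply Rlt_le_trans with (eps * (m * z x) * Rabs k).
  - apply Rmult_lt_compat_r; assumption.
  - replace (eps * (m * z x) * Rabs k) with (eps * z x * (m * Rabs k)) by ring.
    replace (eps * (Rabs h * z x)) with (eps * z x * Rabs h) by ring.
    apply Rmult_le_compat_l; [nra | exact hkh].
Qed.

(** * A scalar equation with monotone right-hand side *)

Lemma is_derive_RInt_continuous (g : R -> R) (x : R) :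
  (forall t, continuous g t) -> is_derive (fun y => RInt g 0 y) x (g x).
Proof.
  intros hg; apply is_derive_RInt with 0; [|apply hg].
  exists (mkposreal 1 Rlt_0_1); intros y _.
  apply (RInt_correct (V := R_CompleteNormedModule)), ex_RInt_continuous.
  intros z _; apply hg.
Qed.

Lemma is_derive_continuous (f : R -> R) (x l : R) :
  is_derive f x l -> continuous f x.
Proof.
  intros h; apply (ex_derive_continuous f); now exists l.
Qed.

Section MonotoneODE.

Context (f G : R -> R) (T : R) (hT : 0 < T)
  (hf : forall x, continuous f x)
  (hG0 : forall a, 0 <= G a)
  (hGmono : forall a b, a <= b -> G a <= G b)
  (hGunif : forall eps, 0 < eps -> exists d, 0 < d /\
     forall a b, Rabs (a - b) <= d -> Rabs (G a - G b) <= eps).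

Lemma unif_continuous_continuous (x : R) : continuous G x.
Proof.
  apply continuity_pt_filterlim, (continuity_pt_locally G x).
  intros eps; destruct (hGunif (eps / 2)) as [d [hd hd']].
  { assert (h := cond_pos eps); lra. }
  exists (mkposreal d hd); intros y hy.
  apply Rle_lt_trans with (eps / 2).
  - apply hd'; left; exact hy.
  - assert (h := cond_pos eps); lra.
Qed.

Lemma continuous_Rmax_0 (x : R) : continuous (Rmax 0) x.
Proof.
  apply continuity_pt_filterlim, (continuity_pt_locally (Rmax 0) x).
  intros eps; exists eps; intros y hy; change (Rabs (y - x) < eps) in hy.
  revert hy; unfold Rmax; repeat destruct Rle_dec; unfold Rabs; repeat destruct Rcase_abs; lra.
Qed.

(* Tonelli's scheme: delaying the unknown by [d] turns the equation into an
   explicit recursion, exact on [0, k d] after [k] steps. *)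
Fixpoint tonelli (d : R) (k : nat) : R -> R :=
  match k with
  | O => fun _ => 0
  | S k' => fun x => RInt (fun t => f t - G (tonelli d k' (Rmax 0 (t - d)))) 0 x
  end.

Lemma continuous_delayed_field (d : R) (y : R -> R) :
  (forall x, continuous y x) ->
  forall x, continuous (fun t => f t - G (y (Rmax 0 (t - d)))) x.
Proof.
  intros hy x.
  apply (continuous_minus (V := R_NormedModule)); [apply hf|].
  apply (continuous_comp (fun t => y (Rmax 0 (t - d))) G); [|apply unif_continuous_continuous].
  apply (continuous_comp (fun t => Rmax 0 (t - d)) y); [|apply hy].
  apply (continuous_comp (fun t => t - d) (Rmax 0)); [|apply continuous_Rmax_0].
  apply (continuous_minus (V := R_NormedModule)); [apply continuous_id | apply continuous_const].
Qed.

Lemma tonelli_continuous (d : R) (k : nat) (x : R) : continuous (tonelli d k) x.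
Proof.
  revert x; induction k as [|k IH]; intros x; simpl.
  - apply continuous_const.
  - eapply is_derive_continuous, is_derive_RInt_continuous.
    apply continuous_delayed_field, IH.
Qed.

Lemma is_derive_tonelli_S (d : R) (k : nat) (x : R) :
  is_derive (tonelli d (S k)) x (f x - G (tonelli d k (Rmax 0 (x - d)))).
Proof.
  apply (is_derive_RInt_continuous
           (fun t => f t - G (tonelli d k (Rmax 0 (t - d))))).
  apply continuous_delayed_field, tonelli_continuous.
Qed.

(** Induction on [k]: for arguments up to [(k + 1) d] the delayed time is at most [k d], where the
    two previous iterates already agree. *)
Lemma tonelli_stable (d : R) (k : nat) (x : R) :
  0 < d -> 0 <= x <= INR k * d -> tonelli d (S k) x = tonelli d k x.
Proof.
  intros hd; revert x; induction k as [|k IH]; intros x hx.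
  - simpl in hx |- *; replace x with 0 by lra; apply (RInt_point (V := R_CompleteNormedModule)).
  - change (RInt (fun t => f t - G (tonelli d (S k) (Rmax 0 (t - d)))) 0 x
            = RInt (fun t => f t - G (tonelli d k (Rmax 0 (t - d)))) 0 x).
    apply RInt_ext; intros t; rewrite Rmin_left, Rmax_right by lra; intros ht.
    rewrite IH; [reflexivity|].
    rewrite S_INR in hx; split; [apply Rmax_l | apply Rmax_lub; [|nra]].
    apply Rmult_le_pos; [apply pos_INR | lra].
Qed.

Lemma delayed_solution_exists (d : R) : 0 < d ->
  exists y, y 0 = 0 /\
    forall x, 0 <= x <= T -> is_derive y x (f x - G (y (Rmax 0 (x - d)))).
Proof.
  intros hd.
  destruct (INR_unbounded (T / d)) as [N hN].
  assert (hN' : T <= INR N * d).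
  { apply Rlt_le, Rmult_lt_reg_r with (/ d); [now apply Rinv_0_lt_compat|].
    rewrite Rmult_assoc, Rinv_r, Rmult_1_r by lra; exact hN. }
  exists (tonelli d (S N)); split; [apply (RInt_point (V := R_CompleteNormedModule))|].
  intros x hx; rewrite tonelli_stable; [apply is_derive_tonelli_S | exact hd |].
  split; [apply Rmax_l | apply Rmax_lub; lra].
Qed.

(** The defect is [eps]; the slope bound [M] is kept separate so that it can be uniform in [eps] and
    survive in the limit. *)
Definition eps_solution (M eps : R) (y : R -> R) : Prop :=
  y 0 = 0 /\ exists dy, forall x, 0 <= x <= T ->
    is_derive y x (dy x) /\ Rabs (dy x) <= M /\ Rabs (dy x - (f x - G (y x))) <= eps.

(** Since [G >= 0], a delayed solution stays below [m * T]; monotonicity then caps [G] by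
    [G (m * T)], which bounds the slope independently of the delay. *)
Lemma eps_solution_exists :
  exists M, 0 <= M /\ forall eps, 0 < eps -> exists y, eps_solution M eps y.
Proof.
  destruct (continuity_ab_maj (fun x => Rabs (f x)) 0 T) as [x0 [hx0 _]]; [lra | |].
  { intros x _; apply (continuity_pt_comp f Rabs); [|apply Rcontinuity_abs].
    apply continuity_pt_filterlim, hf. }
  set (m := Rabs (f x0)); fold m in hx0.
  assert (hm : 0 <= m) by apply Rabs_pos.
  assert (hG := hG0 (m * T)).
  exists (m + G (m * T)); split; [lra|].
  set (M := m + G (m * T)) in *.
  intros eps heps; destruct (hGunif eps heps) as [r [hr hGr]].
  (* During one delay [y] moves by at most [M * d <= r], within the modulus of [G]; the [+ 1] avoids
     dividing by zero. *)
  set (d := r / (M + 1)).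
  assert (hd : 0 < d) by (apply Rdiv_lt_0_compat; unfold M; lra).
  assert (hMd : M * d <= r).
  { assert (d * (M + 1) = r) by (unfold d; field; unfold M; lra); nra. }
  destruct (delayed_solution_exists d hd) as [y [hy0 hy]].
  set (dy := fun x => f x - G (y (Rmax 0 (x - d)))).
  assert (hclamp : forall x, 0 <= x <= T -> 0 <= Rmax 0 (x - d) <= x).
  { intros x hx; split; [apply Rmax_l | apply Rmax_lub; lra]. }
  assert (hfm : forall x, 0 <= x <= T -> - m <= f x <= m).
  { intros x hx; apply Rabs_le_between, hx0, hx. }
  assert (hyub : forall x, 0 <= x <= T -> y x <= m * T).
  { intros x hx.
    assert (h : y x - y 0 <= m * (x - 0)).
    { apply (derive_le_bound y dy); [lra | intros; apply hy; lra |].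
      intros t ht; unfold dy; assert (h := hG0 (y (Rmax 0 (t - d)))).
      specialize (hfm t ltac:(lra)); lra. }
    nra. }
  assert (hdy : forall x, 0 <= x <= T -> Rabs (dy x) <= M).
  { intros x hx; apply Rabs_le; unfold dy, M.
    specialize (hfm x hx); specialize (hclamp x hx).
    assert (h := hG0 (y (Rmax 0 (x - d)))).
    assert (h' : G (y (Rmax 0 (x - d))) <= G (m * T)) by (apply hGmono, hyub; lra).
    lra. }
  exists y; split; [exact hy0|]; exists dy; intros x hx.
  split; [apply hy, hx|]; split; [apply hdy, hx|].
  unfold dy; replace (_ - _) with (G (y x) - G (y (Rmax 0 (x - d)))) by ring.
  apply hGr; specialize (hclamp x hx).
  apply Rle_trans with (2 := hMd), Rle_trans with (M * (x - Rmax 0 (x - d))).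
  - apply (derive_abs_bound y dy); [lra | intros; apply hy; lra | intros; apply hdy; lra].
  - assert (x - d <= Rmax 0 (x - d)) by apply Rmax_r.
    apply Rmult_le_compat_l; unfold M; lra.
Qed.

(** Wherever [y1] exceeds [y2], monotonicity gives [G (y1 x) >= G (y2 x)], so the gap grows at most
    at the rate [e1 + e2] of the defects. This replaces a Lipschitz condition. *)
Lemma eps_solutions_close (M e1 e2 : R) (y1 y2 : R -> R) :
  eps_solution M e1 y1 -> eps_solution M e2 y2 ->
  forall x, 0 <= x <= T -> y1 x - e1 * x <= y2 x + e2 * x.
Proof.
  intros [h10 [d1 h1]] [h20 [d2 h2]] x hx.
  enough (y1 x - y2 x - (e1 + e2) * x <= 0) by lra.
  apply (nonpos_of_derive_nonpos (fun x => y1 x - y2 x - (e1 + e2) * x)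
           (fun x => d1 x - d2 x - (e1 + e2)) 0); [lra | | | rewrite h10, h20; lra].
  - intros t ht.
    destruct (h1 t ltac:(lra)) as [h1d _], (h2 t ltac:(lra)) as [h2d _].
    auto_derive; [repeat split; [now exists (d1 t) | now exists (d2 t)]|].
    replace (Derive (fun x => y1 x) t) with (d1 t) by (symmetry; apply is_derive_unique, h1d).
    replace (Derive (fun x => y2 x) t) with (d2 t) by (symmetry; apply is_derive_unique, h2d).
    ring.
  - intros t ht hpos.
    destruct (h1 t ltac:(lra)) as [_ [hM h1e]], (h2 t ltac:(lra)) as [_ [_ h2e]].
    apply Rabs_le_between in h1e, h2e.
    assert (0 <= e1) by lra. assert (0 <= e2) by lra.
    assert (G (y2 t) <= G (y1 t)) by (apply hGmono; nra).
    lra.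
Qed.

(* The limit is the supremum of the corrected eps-solutions [y - eps x]. *)
Lemma eps_solutions_limit (M : R) :
  (forall eps, 0 < eps -> exists y, eps_solution M eps y) ->
  exists y : R -> R, forall eps z x, 0 < eps -> eps_solution M eps z ->
    0 <= x <= T -> Rabs (z x - y x) <= eps * x.
Proof.
  intros hex.
  set (E := fun x a => exists eps z, eps_solution M eps z /\ a = z x - eps * x).
  exists (fun x => real (Lub_Rbar (E x))).
  intros eps z x heps hz hx.
  destruct (Lub_Rbar_correct (E x)) as [hub hlub].
  assert (h1 : Rbar_le (z x - eps * x) (Lub_Rbar (E x))) by (apply hub; now exists eps, z).
  assert (h2 : Rbar_le (Lub_Rbar (E x)) (z x + eps * x)).
  { apply hlub; intros a [e [w [hw ->]]].
    apply (eps_solutions_close M e eps w z hw hz x hx). }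
  (* The two bounds exclude the infinite values, which [real] would send to 0. *)
  destruct (Lub_Rbar (E x)) as [l | |]; simpl in *; try easy.
  apply Rabs_le; lra.
Qed.

(** The limit [y] of the approximations is Lipschitz, so [f - G y] can be integrated; its primitive
    [Y] equals [y] because both are close to the same approximate solution. *)
Lemma monotone_ode_solution :
  exists y : R -> R, y 0 = 0 /\
    forall x, 0 <= x <= T -> is_derive y x (f x - G (y x)).
Proof.
  destruct eps_solution_exists as [M [hM hex]].
  destruct (eps_solutions_limit M hex) as [y hy].
  assert (hlip : forall a b, 0 <= a <= T -> 0 <= b <= T -> a <= b ->
    Rabs (y b - y a) <= M * (b - a)).
  { intros a b ha hb hab; apply le_epsilon; intros e he.
    set (e' := e / (2 * T)).
    assert (he' : 0 < e') by (apply Rdiv_lt_0_compat; lra).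
    assert (heq : e' * T = e / 2) by (unfold e'; field; lra).
    destruct (hex e' he') as [z hz].
    assert (h1 := hy e' z a he' hz ha); assert (h2 := hy e' z b he' hz hb).
    destruct hz as [_ [dz hz]].
    assert (h3 : Rabs (z b - z a) <= M * (b - a)).
    { apply (derive_abs_bound z dz); [assumption | |]; intros; apply hz; lra. }
    apply Rabs_le_between in h1, h2, h3; apply Rabs_le; nra. }
  (* Freezing [y] outside [0, T] makes the integrand continuous on the whole line. *)
  set (clamp := fun x => Rmin T (Rmax 0 x)).
  assert (hclamp : forall x, 0 <= clamp x <= T).
  { intros x; unfold clamp, Rmin, Rmax; repeat destruct Rle_dec; lra. }
  assert (hclamp_id : forall x, 0 <= x <= T -> clamp x = x).
  { intros x hx; unfold clamp, Rmin, Rmax; repeat destruct Rle_dec; lra. }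
  assert (hclamp_lip : forall a b, a <= b -> 0 <= clamp b - clamp a <= b - a).
  { intros a b hab; unfold clamp, Rmin, Rmax; repeat destruct Rle_dec; lra. }
  assert (hcont : forall x, continuous (fun t => y (clamp t)) x).
  { intros x; apply continuity_pt_filterlim, (continuity_pt_locally (fun t => y (clamp t)) x).
    intros eps; assert (heps := cond_pos eps).
    assert (hd : 0 < eps / (M + 1)) by (apply Rdiv_lt_0_compat; lra).
    exists (mkposreal _ hd); intros t ht; change (Rabs (t - x) < eps / (M + 1)) in ht.
    apply Rle_lt_trans with (M * Rabs (t - x)).
    - destruct (Rle_dec x t) as [h | h].
      + specialize (hclamp_lip x t h).
        apply Rle_trans with (M * (clamp t - clamp x)); [apply hlip; (apply hclamp || lra)|].
        apply Rmult_le_compat_l; [assumption|]; rewrite Rabs_pos_eq; lra.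
      + specialize (hclamp_lip t x ltac:(lra)).
        rewrite Rabs_minus_sym, (Rabs_minus_sym t).
        apply Rle_trans with (M * (clamp x - clamp t)); [apply hlip; (apply hclamp || lra)|].
        apply Rmult_le_compat_l; [assumption|]; rewrite Rabs_pos_eq; lra.
    - assert (heq : eps / (M + 1) * (M + 1) = eps) by (field; lra).
      assert (0 <= Rabs (t - x)) by apply Rabs_pos; nra. }
  set (g := fun t => f t - G (y (clamp t))).
  assert (hg : forall x, continuous g x).
  { intros x; apply (continuous_minus (V := R_NormedModule)); [apply hf|].
    apply (continuous_comp (fun t => y (clamp t)) G); [apply hcont | apply unif_continuous_continuous]. }
  set (Y := fun x => RInt g 0 x).
  assert (hY0 : Y 0 = 0) by apply (RInt_point (V := R_CompleteNormedModule)).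
  assert (hY : forall x, is_derive Y x (g x)).
  { intros x; apply is_derive_RInt_continuous, hg. }
  assert (hYy : forall x, 0 <= x <= T -> Y x = y x).
  { intros x hx; apply Rminus_diag_uniq, Rabs_eq_0.
    apply Rle_antisym; [|apply Rabs_pos].
    apply le_epsilon; intros e he; rewrite Rplus_0_l.
    set (e1 := e / (3 * T)).
    assert (he1 : 0 < e1) by (apply Rdiv_lt_0_compat; lra).
    destruct (hGunif e1 he1) as [r [hr hGr]].
    (* The bound [r / T] keeps [z] within [r] of [y], so their images under [G] differ by at most
       [e1]; the bound [e1] controls the defect. The errors add up to [2 e / 3] for [Y - z] and
       [e / 3] for [z - y]. *)
    set (e2 := Rmin e1 (r / T)).
    assert (he2 : 0 < e2) by (apply Rmin_pos; [|apply Rdiv_lt_0_compat]; lra).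
    assert (he2T : e2 * T <= r).
    { assert (h : e2 <= r / T) by apply Rmin_r.
      replace r with (r / T * T) by (field; lra); nra. }
    assert (he21 : e2 <= e1) by apply Rmin_l.
    destruct (hex e2 he2) as [z hz].
    assert (hzy := hy e2 z); specialize (fun x => hzy x he2 hz).
    destruct hz as [hz0 [dz hz]].
    assert (h1 : Rabs ((Y x - z x) - (Y 0 - z 0)) <= (2 * e1) * (x - 0)).
    { apply (derive_abs_bound (fun x => Y x - z x) (fun x => g x - dz x)); [lra | |].
      - intros t ht; apply (is_derive_minus Y z); [apply hY | apply hz; lra].
      - intros t ht; destruct (hz t ltac:(lra)) as [_ [_ h]].
        assert (h' : Rabs (G (z t) - G (y t)) <= e1).
        { apply hGr; apply Rle_trans with (1 := hzy t ltac:(lra)); nra. }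
        unfold g; rewrite hclamp_id by lra.
        apply Rabs_le_between in h, h'; apply Rabs_le; lra. }
    assert (h2 := hzy x hx).
    rewrite hY0, hz0 in h1.
    assert (e1 * T = e / 3) by (unfold e1; field; lra).
    apply Rabs_le_between in h1, h2; apply Rabs_le; nra. }
  exists Y; split; [exact hY0|].
  intros x hx; rewrite hYy by exact hx.
  rewrite <- (hclamp_id x hx) at 3; apply hY.
Qed.

End MonotoneODE.

(** * Functions with a limit at infinity *)

Lemma is_lim_p_infty_eps (f : R -> R) (l eps : R) :
  is_lim f p_infty l -> 0 < eps -> exists X, forall x, X <= x -> Rabs (f x - l) < eps.
Proof.
  intros h heps.
  destruct (proj2 (is_lim_spec f p_infty l) h (mkposreal eps heps)) as [M hM].
  exists (M + 1); intros x hx; apply hM; lra.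
Qed.

Lemma is_lim_m_infty_eps (f : R -> R) (l eps : R) :
  is_lim f m_infty l -> 0 < eps -> exists X, forall x, x <= X -> Rabs (f x - l) < eps.
Proof.
  intros h heps.
  destruct (proj2 (is_lim_spec f m_infty l) h (mkposreal eps heps)) as [M hM].
  exists (M - 1); intros x hx; apply hM; lra.
Qed.

(** By the mean value theorem the increment of [v] over a unit interval is a value of [p].
    Convergence of [p] itself is not known at this stage. *)
Lemma derive_small_near_p_infty (v p : R -> R) (l eps : R) :
  (forall x, is_derive v x (p x)) -> is_lim v p_infty l -> 0 < eps ->
  exists X0, forall X, X0 <= X -> exists x, X <= x <= X + 1 /\ Rabs (p x) <= eps.
Proof.
  intros hv hl heps.
  destruct (is_lim_p_infty_eps v l (eps / 2) hl) as [X0 hX0]; [lra|].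
  exists X0; intros X hX.
  destruct (mean_value v p X (X + 1)) as [x [hx heq]]; [lra | intros; apply hv |].
  exists x; split; [lra|].
  assert (h1 := hX0 X hX); assert (h2 := hX0 (X + 1) ltac:(lra)).
  replace (p x) with (v (X + 1) - v X) by lra.
  apply Rabs_def2 in h1, h2; apply Rabs_le; lra.
Qed.

Lemma le_limit_of_nondecreasing (v p : R -> R) (l a : R) :
  (forall x, a <= x -> is_derive v x (p x)) -> (forall x, a <= x -> 0 <= p x) ->
  is_lim v p_infty l -> v a <= l.
Proof.
  intros hv hp hl; apply Rnot_lt_le; intros h.
  destruct (is_lim_p_infty_eps v l (v a - l) hl) as [X hX]; [lra|].
  set (x := Rmax a X).
  assert (hx : a <= x /\ X <= x) by (split; [apply Rmax_l | apply Rmax_r]).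
  specialize (hX x ltac:(lra)); apply Rabs_def2 in hX.
  assert (h' : - v x - - v a <= 0 * (x - a)).
  { apply (derive_le_bound (fun t => - v t) (fun t => - p t)); [lra | |].
    - intros t ht; apply (is_derive_opp v), hv; lra.
    - intros t ht; specialize (hp t ltac:(lra)); lra. }
  lra.
Qed.

(** * Estimates valid for every profile *)

Section Profile.

Context (s kappa : R) (hs : 0 < s) (hkappa : 0 < kappa) (hks : 36 * kappa * s ^ 2 <= 1).

(** Expands to [w^3 - 3 s^2 w + 2 s^3], the flux minus [sigma w], shifted to vanish at both end
    states. The double root at [s] causes the algebraic decay at +oo, the simple root the
    exponential one at -oo. *)
Definition cubic (w : R) : R := (w - s) ^ 2 * (w + 2 * s).

Lemma is_derive_cubic (w : R) : is_derive cubic w (3 * w ^ 2 - 3 * s ^ 2).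
Proof. unfold cubic; auto_derive; [easy | ring]. Qed.

Lemma is_derive_cubic_comp (v : R -> R) (x p : R) :
  is_derive v x p -> is_derive (fun t => cubic (v t)) x ((3 * v x ^ 2 - 3 * s ^ 2) * p).
Proof.
  intros h; rewrite Rmult_comm.
  apply (is_derive_comp cubic v); [apply is_derive_cubic | exact h].
Qed.

Lemma cubic_nonneg (w : R) : - 2 * s <= w -> 0 <= cubic w.
Proof. intros h; apply Rmult_le_pos; [apply pow2_ge_0 | lra]. Qed.

(* The profile equation integrated once, as a planar system. *)
Definition heteroclinic (v p : R -> R) : Prop :=
  (forall x, is_derive v x (p x)) /\
  (forall x, is_derive p x ((p x - cubic (v x)) / kappa)) /\
  is_lim v m_infty (- 2 * s) /\ is_lim v p_infty s.

(* The integration constant is zero: along points where [v'] is small,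
   [v - kappa v'] has small increments over bounded distances. *)
Lemma wave_profile_heteroclinic (v : R -> R) :
  wave_profile kappa (3 * s ^ 2) (- 2 * s) s v -> heteroclinic v (Derive v).
Proof.
  intros [hd [heq [hm hp]]].
  assert (h1 : forall x, is_derive v x (Derive v x)).
  { intros x; apply Derive_correct, (hd 1%nat); lia. }
  assert (h2 : forall x, is_derive (Derive v) x (Derive_n v 2 x)).
  { intros x; apply (Derive_correct (Derive v)), (hd 2%nat); lia. }
  assert (h3 : forall x, is_derive (Derive_n v 2) x (Derive_n v 3 x)).
  { intros x; apply (Derive_correct (Derive_n v 2)), (hd 3%nat); lia. }
  set (g := fun x => kappa * Derive_n v 2 x - Derive v x + cubic (v x)).
  assert (hg : forall x, is_derive g x 0).
  { intros x.
    replace 0 with (kappa * Derive_n v 3 x - Derive_n v 2 x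
                    + (3 * v x ^ 2 - 3 * s ^ 2) * Derive v x).
    - apply (is_derive_plus (fun x => kappa * Derive_n v 2 x - Derive v x)).
      + apply (is_derive_minus (fun x => kappa * Derive_n v 2 x)); [|apply h2].
        apply is_derive_scal, h3.
      + apply is_derive_cubic_comp, h1.
    - specialize (heq x).
      rewrite (is_derive_unique _ _ _ (is_derive_pow v 3 x _ (h1 x))) in heq.
      simpl in heq |- *; lra. }
  set (C := g 0).
  assert (hgC : forall x, Derive_n v 2 x = (Derive v x - cubic (v x) + C) / kappa).
  { intros x; assert (h : g x = C).
    { apply constant_of_derive_zero, hg. }
    unfold g in h; field_simplify_eq; lra. }
  assert (hC : C = 0).
  { destruct (Req_dec C 0) as [h0 | hne]; [exact h0 | exfalso].
    (* Between slow points [a] and [b] at distance at least 1, [v - kappa v'] changes by at most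
       [e / 4], whereas its slope [cubic (v x) - C] has modulus at least [3 e / 4]. *)
    assert (hpos := Rabs_pos_lt C hne); set (e := Rabs C) in *.
    destruct (continuity_pt_nbhd cubic s (e / 4)) as [r [hr hcub]]; [| lra |].
    { eapply is_derive_continuity_pt, is_derive_cubic. }
    assert (hr' : 0 < Rmin r (e / 16)) by (apply Rmin_pos; lra).
    destruct (is_lim_p_infty_eps v s _ hp hr') as [X1 hX1].
    assert (he' : 0 < e / (16 * kappa)) by (apply Rdiv_lt_0_compat; lra).
    destruct (derive_small_near_p_infty v (Derive v) s _ h1 hp he') as [X2 hX2].
    set (X := Rmax X1 X2).
    assert (hX : X1 <= X /\ X2 <= X) by (split; [apply Rmax_l | apply Rmax_r]).
    destruct (hX2 X) as [a [ha hpa]]; [lra|].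
    destruct (hX2 (X + 2)) as [b [hb hpb]]; [lra|].
    destruct (mean_value (fun x => v x - kappa * Derive v x)
                (fun x => Derive v x - kappa * Derive_n v 2 x) a b) as [x [hx hmv]]; [lra | |].
    { intros x _; apply (is_derive_minus v); [apply h1 | apply is_derive_scal, h2]. }
    rewrite hgC in hmv.
    replace (Derive v x - _) with (cubic (v x) - C) in hmv by (field; lra).
    assert (hva := hX1 a ltac:(lra)); assert (hvb := hX1 b ltac:(lra)).
    assert (hvx := hX1 x ltac:(lra)).
    assert (hm1 := Rmin_l r (e / 16)); assert (hm2 := Rmin_r r (e / 16)).
    specialize (hcub (v x) ltac:(lra)).
    replace (cubic s) with 0 in hcub by (unfold cubic; ring).
    assert (hkp : forall q, Rabs q <= e / (16 * kappa) -> - (e / 16) <= kappa * q <= e / 16).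
    { intros q hq; replace (e / 16) with (kappa * (e / (16 * kappa))) by (field; lra).
      apply Rabs_le_between in hq.
      split; [rewrite Ropp_mult_distr_r|]; apply Rmult_le_compat_l; lra. }
    apply hkp in hpa, hpb.
    apply Rabs_def2 in hva, hvb, hcub.
    revert hpos; unfold e, Rabs in *; destruct (Rcase_abs C); intros; nra. }
  split; [exact h1|]; split; [|split; assumption].
  intros x; rewrite <- (Rplus_0_r (_ - _)), <- hC, <- hgC; apply h2.
Qed.

(** * Barriers and confinement to (-2s, s) *)

Lemma heteroclinic_frequently_slow (v p : R -> R) :
  heteroclinic v p -> forall X, exists x, X <= x /\ Rabs (p x) <= 1.
Proof.
  intros [hv [_ [_ hlim]]] X.
  destruct (derive_small_near_p_infty v p s 1 hv hlim) as [X0 hX0]; [lra|].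
  destruct (hX0 (Rmax X X0)) as [x [hx hpx]]; [apply Rmax_r|].
  exists x; split; [|exact hpx].
  apply Rle_trans with (2 := proj1 hx), Rmax_l.
Qed.

Lemma heteroclinic_derive_nonneg (v p : R -> R) (a : R) :
  heteroclinic v p -> (forall x, a <= x -> - 2 * s <= v x) -> 0 <= p a.
Proof.
  intros h hv.
  apply (nonneg_of_backward_gronwall p (fun x => (p x - cubic (v x)) / kappa) kappa a 1).
  - exact hkappa.
  - intros x _; apply h.
  - intros x hx; assert (h0 := cubic_nonneg (v x) (hv x hx)).
    field_simplify; lra.
  - intros X; destruct (heteroclinic_frequently_slow v p h X) as [x [hx hpx]].
    exists x; split; [exact hx|]; apply Rabs_le_between in hpx; lra.
Qed.

Lemma cubic_bound (w : R) : - 2 * s <= w <= s -> 0 <= cubic w <= 27 * s ^ 3.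
Proof.
  intros h; split; [apply cubic_nonneg; lra|].
  unfold cubic.
  assert ((w - s) ^ 2 <= (3 * s) ^ 2) by nra.
  apply Rle_trans with ((3 * s) ^ 2 * (3 * s)); [|lra].
  apply Rmult_le_compat; try lra; apply pow2_ge_0.
Qed.

(** Backward Gronwall for [A F(v) + B p] with rate constant [k * kappa]; [F(v)] is bounded and [p]
    is frequently bounded, which supplies the lower bound. The factor [k] is free and tuned to each
    barrier. *)
Lemma heteroclinic_barrier (v p : R -> R) (A B k a : R) :
  heteroclinic v p -> 0 < k -> (forall x, a <= x -> - 2 * s <= v x <= s) ->
  (forall x, a <= x ->
     k * (A * (kappa * (3 * v x ^ 2 - 3 * s ^ 2) * p x) + B * (p x - cubic (v x)))
     <= A * cubic (v x) + B * p x) ->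
  0 <= A * cubic (v a) + B * p a.
Proof.
  intros h hk hv hd.
  apply (nonneg_of_backward_gronwall (fun x => A * cubic (v x) + B * p x)
    (fun x => A * ((3 * v x ^ 2 - 3 * s ^ 2) * p x) + B * ((p x - cubic (v x)) / kappa))
    (k * kappa) a (Rabs A * (27 * s ^ 3) + Rabs B)).
  - now apply Rmult_lt_0_compat.
  - intros x _; apply (is_derive_plus (fun x => A * cubic (v x))); apply is_derive_scal.
    + apply is_derive_cubic_comp, h.
    + apply h.
  - intros x hx; apply Rle_trans with (2 := hd x hx), Req_le; field; lra.
  - intros X; destruct (heteroclinic_frequently_slow v p h (Rmax a X)) as [x [hx hpx]].
    assert (hax := Rmax_l a X); assert (hXx := Rmax_r a X).
    exists x; split; [lra|].
    assert (hc := cubic_bound (v x) (hv x ltac:(lra))).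
    assert (h1 : Rabs (A * cubic (v x)) <= Rabs A * (27 * s ^ 3)).
    { rewrite Rabs_mult; apply Rmult_le_compat_l; [apply Rabs_pos|].
      rewrite Rabs_pos_eq; apply hc. }
    assert (h2 : Rabs (B * p x) <= Rabs B * 1).
    { rewrite Rabs_mult; apply Rmult_le_compat_l; [apply Rabs_pos | exact hpx]. }
    apply Rabs_le_between in h1, h2; lra.
Qed.

Lemma derive_cubic_bound (w : R) :
  - 2 * s <= w <= s -> - 3 * s ^ 2 <= 3 * w ^ 2 - 3 * s ^ 2 <= 9 * s ^ 2.
Proof. intros h; nra. Qed.

Lemma kappa_derive_cubic_bound (w p : R) :
  - 2 * s <= w <= s -> 0 <= p ->
  - (3 * kappa * s ^ 2) * p <= kappa * (3 * w ^ 2 - 3 * s ^ 2) * p <= (9 * kappa * s ^ 2) * p.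
Proof.
  intros h hp; apply derive_cubic_bound in h.
  split; apply Rmult_le_compat_r; nra.
Qed.

(** For [2 F(v) - p] and [k = 2] the barrier condition reduces to [4 kappa F'(v) <= 1] where
    [p > 0], which follows from [F' <= 9 s^2]. Only the half-line after [a] is involved, since
    confinement is not yet available. *)
Lemma heteroclinic_upper_bound (v p : R -> R) (a : R) :
  heteroclinic v p -> (forall x, a <= x -> - 2 * s <= v x) -> p a <= 2 * cubic (v a).
Proof.
  intros h hv.
  assert (hp : forall x, a <= x -> 0 <= p x).
  { intros x hx; apply (heteroclinic_derive_nonneg v p x h); intros; apply hv; lra. }
  assert (hvs : forall x, a <= x -> - 2 * s <= v x <= s).
  { intros x hx; split; [now apply hv|].
    apply (le_limit_of_nondecreasing v p); [| |apply h].
    - intros; apply h.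
    - intros; apply hp; lra. }
  enough (0 <= 2 * cubic (v a) + - 1 * p a) by lra.
  apply (heteroclinic_barrier v p 2 (- 1) 2 a h); [lra | exact hvs |].
  intros x hx; specialize (hp x hx).
  assert (hk := kappa_derive_cubic_bound (v x) (p x) (hvs x hx) hp).
  nra.
Qed.

(** After the last crossing [m] of [-2s] the half-line bounds hold, so
    [(v + 2s)' <= 18 s^2 (v + 2s)]. Starting from 0 at [m], [v + 2s] could never become positive,
    against the limit at +oo. *)
Lemma heteroclinic_gt_left (v p : R -> R) (x : R) : heteroclinic v p -> - 2 * s < v x.
Proof.
  intros h; apply Rnot_le_lt; intros hle.
  assert (h' := h); destruct h' as [hv [_ [_ hlim]]].
  destruct (is_lim_p_infty_eps v s s hlim hs) as [X hX].
  set (b := Rmax x X).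
  assert (hb : x <= b /\ X <= b) by (split; [apply Rmax_l | apply Rmax_r]).
  assert (hafter : forall t, b <= t -> 0 < v t).
  { intros t ht; specialize (hX t ltac:(lra)); apply Rabs_def2 in hX; lra. }
  destruct (last_crossing v x b (- 2 * s)) as [m [hm0 [hm1 hm2]]]; [lra | | lra | |].
  { intros t _; eapply is_derive_continuity_pt, hv. }
  { specialize (hafter b ltac:(lra)); lra. }
  assert (hge : forall t, m <= t -> - 2 * s <= v t).
  { intros t [ht | <-]; [|lra].
    destruct (Rle_dec t b) as [htb | htb]; [left; apply hm2; lra|].
    specialize (hafter t ltac:(lra)); lra. }
  assert (hg : v b + 2 * s <= (v m + 2 * s) * exp (18 * s ^ 2 * (b - m))).
  { apply (gronwall (fun t => v t + 2 * s) p); [lra | |].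
    - intros t _; apply is_derive_add_const, hv.
    - intros t ht.
      assert (h1 : forall y, t <= y -> - 2 * s <= v y) by (intros; apply hge; lra).
      assert (h2 : v t <= s).
      { apply (le_limit_of_nondecreasing v p); [intros; apply hv | | exact hlim].
        intros y hy; apply (heteroclinic_derive_nonneg v p y h); intros; apply h1; lra. }
      assert (h3 := heteroclinic_upper_bound v p t h h1).
      specialize (h1 t ltac:(lra)).
      apply Rle_trans with (1 := h3); unfold cubic.
      assert ((v t - s) ^ 2 <= 9 * s ^ 2) by nra.
      nra. }
  rewrite hm1 in hg.
  specialize (hafter b ltac:(lra)); nra.
Qed.

Lemma heteroclinic_derive_nonneg_everywhere (v p : R -> R) (x : R) :
  heteroclinic v p -> 0 <= p x.
Proof.
  intros h; apply (heteroclinic_derive_nonneg v p x h).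
  intros y _; left; now apply (heteroclinic_gt_left v p).
Qed.

Lemma heteroclinic_le_twice_cubic (v p : R -> R) (x : R) :
  heteroclinic v p -> p x <= 2 * cubic (v x).
Proof.
  intros h; apply (heteroclinic_upper_bound v p x h).
  intros y _; left; now apply (heteroclinic_gt_left v p).
Qed.

Lemma heteroclinic_le_right (v p : R -> R) (x : R) : heteroclinic v p -> v x <= s.
Proof.
  intros h; apply (le_limit_of_nondecreasing v p); [| |apply h].
  - intros y _; apply h.
  - intros y _; now apply (heteroclinic_derive_nonneg_everywhere v p).
Qed.

(** [s - v] is positive near -oo and shrinks at most exponentially, because
    [v' <= 2 F(v) <= 18 s^2 (s - v)]. *)
Lemma heteroclinic_lt_right (v p : R -> R) (x : R) : heteroclinic v p -> v x < s.
Proof.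
  intros h.
  assert (h' := h); destruct h' as [hv [_ [hlim _]]].
  destruct (is_lim_m_infty_eps v (- 2 * s) s hlim hs) as [X hX].
  set (a := Rmin x X).
  assert (ha : a <= x /\ a <= X) by (split; [apply Rmin_l | apply Rmin_r]).
  specialize (hX a ltac:(lra)); apply Rabs_def2 in hX.
  assert (hg : v x + - s <= (v a + - s) * exp (- (18 * s ^ 2) * (x - a))).
  { apply (gronwall (fun t => v t + - s) p); [lra | |].
    - intros t _; apply is_derive_add_const, hv.
    - intros t _; apply Rle_trans with (1 := heteroclinic_le_twice_cubic v p t h).
      assert (h1 := heteroclinic_gt_left v p t h).
      assert (h2 := heteroclinic_le_right v p t h).
      unfold cubic.
      assert ((s - v t) * (v t + 2 * s) <= 9 * s ^ 2) by nra.
      nra. }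
  assert (he := exp_pos (- (18 * s ^ 2) * (x - a))).
  assert (0 < (- (v a + - s)) * exp (- (18 * s ^ 2) * (x - a))) by (apply Rmult_lt_0_compat; lra).
  lra.
Qed.

Lemma heteroclinic_range (v p : R -> R) (x : R) : heteroclinic v p -> - 2 * s <= v x <= s.
Proof.
  intros h; split; [left; now apply (heteroclinic_gt_left v p) | now apply (heteroclinic_le_right v p)].
Qed.

Lemma heteroclinic_cubic_pos (v p : R -> R) (x : R) : heteroclinic v p -> 0 < cubic (v x).
Proof.
  intros h.
  assert (h1 := heteroclinic_gt_left v p x h); assert (h2 := heteroclinic_lt_right v p x h).
  apply Rmult_lt_0_compat; [apply pow2_gt_0|]; lra.
Qed.

Lemma rate_bounds : 0 < 4 * sqrt 3 - 6 < 1.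
Proof.
  assert (h := sqrt_def 3 ltac:(lra)); assert (h0 := sqrt_pos 3); nra.
Qed.

(* [c = 4 sqrt 3 - 6] is the positive root of [c^2 / 12 = 1 - c], the barrier
   condition at the extreme value [kappa s^2 = 1/36]. *)
Lemma heteroclinic_ge_rate_cubic (v p : R -> R) (x : R) :
  heteroclinic v p -> (4 * sqrt 3 - 6) * cubic (v x) <= p x.
Proof.
  intros h; set (c := 4 * sqrt 3 - 6).
  assert (hc : 0 < c < 1) by apply rate_bounds.
  assert (hroot : c ^ 2 = 12 - 12 * c).
  { assert (h3 := sqrt_def 3 ltac:(lra)); unfold c; nra. }
  enough (0 <= - c * cubic (v x) + 1 * p x) by lra.
  apply (heteroclinic_barrier v p (- c) 1 c x h); [lra | intros; now apply (heteroclinic_range v p) |].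
  intros y _.
  assert (hp := heteroclinic_derive_nonneg_everywhere v p y h).
  assert (hk := kappa_derive_cubic_bound (v y) (p y) (heteroclinic_range v p y h) hp).
  assert (hc2 : c * (c * (- (3 * kappa * s ^ 2) * p y))
                <= c * (c * (kappa * (3 * v y ^ 2 - 3 * s ^ 2) * p y))).
  { apply Rmult_le_compat_l; [lra|]; apply Rmult_le_compat_l; [lra|]; apply hk. }
  assert (h4 : c ^ 2 * (3 * kappa * s ^ 2) * p y <= (1 - c) * p y).
  { apply Rmult_le_compat_r; [exact hp|]; rewrite hroot; nra. }
  nra.
Qed.

Lemma heteroclinic_derive_pos (v p : R -> R) (x : R) : heteroclinic v p -> 0 < p x.
Proof.
  intros h; apply Rlt_le_trans with (2 := heteroclinic_ge_rate_cubic v p x h).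
  apply Rmult_lt_0_compat; [apply rate_bounds | now apply (heteroclinic_cubic_pos v p)].
Qed.

Lemma heteroclinic_increasing (v p : R -> R) : heteroclinic v p -> strict_increasing v.
Proof.
  intros h x y hxy.
  destruct (mean_value v p x y hxy) as [t [_ ht]]; [intros; apply h|].
  assert (hp := heteroclinic_derive_pos v p t h); nra.
Qed.

(** The claim is [0 <= F(v) - m p]. With [k = / m] the barrier reduces to [kappa F'(v) <= m (1 - m)
    = 18 kappa s^2 m] where [p > 0], which follows from [m >= 1 / 2]. *)
Lemma heteroclinic_second_derive_le (v p : R -> R) (x : R) :
  heteroclinic v p -> (p x - cubic (v x)) / kappa <= 18 * s ^ 2 * p x.
Proof.
  intros h; set (m := 1 - 18 * kappa * s ^ 2).
  assert (hks0 : 0 < kappa * s ^ 2) by (apply Rmult_lt_0_compat; [|apply pow_lt]; assumption).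
  assert (hm : 1 / 2 <= m) by (unfold m; lra).
  assert (hb : 0 <= 1 * cubic (v x) + - m * p x).
  { apply (heteroclinic_barrier v p 1 (- m) (/ m) x h).
    - apply Rinv_0_lt_compat; lra.
    - intros; now apply (heteroclinic_range v p).
    - intros y _.
      assert (hp := heteroclinic_derive_nonneg_everywhere v p y h).
      assert (hk := kappa_derive_cubic_bound (v y) (p y) (heteroclinic_range v p y h) hp).
      apply Rmult_le_reg_l with m; [lra|].
      rewrite <- Rmult_assoc, Rinv_r, Rmult_1_l by lra.
      assert (hm2 : 9 * kappa * s ^ 2 - m <= - m * m) by (unfold m; nra).
      assert (9 * kappa * s ^ 2 * p y - m * p y <= - m * m * p y) by nra.
      nra. }
  apply Rmult_le_reg_l with kappa; [assumption|].
  replace (kappa * ((p x - cubic (v x)) / kappa)) with (p x - cubic (v x)) by (field; lra).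
  unfold m in hb; lra.
Qed.

(** The claim is [0 <= m p - F(v)]. With [k = / m] the barrier follows from [- kappa F'(v) <= m - 1]
    and [(m - 1)^2 >= 0]. *)
Lemma heteroclinic_second_derive_ge (v p : R -> R) (x : R) :
  heteroclinic v p -> - 3 * s ^ 2 * p x <= (p x - cubic (v x)) / kappa.
Proof.
  intros h; set (m := 1 + 3 * kappa * s ^ 2).
  assert (hks0 : 0 < kappa * s ^ 2) by (apply Rmult_lt_0_compat; [|apply pow_lt]; assumption).
  assert (hm : 1 <= m) by (unfold m; lra).
  assert (hb : 0 <= - 1 * cubic (v x) + m * p x).
  { apply (heteroclinic_barrier v p (- 1) m (/ m) x h).
    - apply Rinv_0_lt_compat; lra.
    - intros; now apply (heteroclinic_range v p).
    - intros y _.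
      assert (hp := heteroclinic_derive_nonneg_everywhere v p y h).
      assert (hk := kappa_derive_cubic_bound (v y) (p y) (heteroclinic_range v p y h) hp).
      apply Rmult_le_reg_l with m; [lra|].
      rewrite <- Rmult_assoc, Rinv_r, Rmult_1_l by lra.
      assert (hm2 : m + (m - 1) <= m * m) by nra.
      assert (hm3 : (m + (m - 1)) * p y <= m * m * p y) by (apply Rmult_le_compat_r; assumption).
      unfold m in *; nra. }
  apply Rmult_le_reg_l with kappa; [assumption|].
  replace (kappa * ((p x - cubic (v x)) / kappa)) with (p x - cubic (v x)) by (field; lra).
  unfold m in hb; lra.
Qed.

(** Once [v] is above [-s] it stays there, where [F' <= 0]; the constant 2 improves to 1, which says
    [v'' <= 0]. *)
Lemma heteroclinic_le_cubic (v p : R -> R) (x : R) :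
  heteroclinic v p -> - s <= v x -> p x <= cubic (v x).
Proof.
  intros h hx.
  enough (0 <= 1 * cubic (v x) + - 1 * p x) by lra.
  apply (heteroclinic_barrier v p 1 (- 1) 1 x h); [lra | intros; now apply (heteroclinic_range v p) |].
  intros y hy.
  assert (hp := heteroclinic_derive_nonneg_everywhere v p y h).
  assert (hv : - s <= v y <= s).
  { split; [|now apply (heteroclinic_le_right v p)].
    destruct hy as [hy | <-]; [|exact hx].
    assert (h' := heteroclinic_increasing v p h x y hy); lra. }
  assert (hd : 3 * v y ^ 2 - 3 * s ^ 2 <= 0) by nra.
  assert (kappa * (3 * v y ^ 2 - 3 * s ^ 2) * p y <= 0).
  { rewrite <- (Rmult_0_l (p y)); apply Rmult_le_compat_r; [exact hp | nra]. }
  lra.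
Qed.

Lemma heteroclinic_log_derive_bounds (v p : R -> R) (x : R) :
  heteroclinic v p ->
  - 3 * s ^ 2 <= (p x - cubic (v x)) / kappa / p x <= 18 * s ^ 2.
Proof.
  intros h; assert (hp := heteroclinic_derive_pos v p x h).
  assert (hle := heteroclinic_second_derive_le v p x h).
  assert (hge := heteroclinic_second_derive_ge v p x h).
  split; [apply (Rle_div_r _ _ _ hp) | apply (Rle_div_l _ _ _ hp)]; assumption.
Qed.

(** * Bounds on the third derivative *)

Lemma is_derive_second (v p : R -> R) (x : R) :
  heteroclinic v p ->
  is_derive (fun t => (p t - cubic (v t)) / kappa) x
    (((p x - cubic (v x)) / kappa - (3 * v x ^ 2 - 3 * s ^ 2) * p x) / kappa).
Proof.
  intros [hv [hp _]].
  apply (is_derive_ext (fun t => / kappa * (p t - cubic (v t)))).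
  { intros t; apply Rmult_comm. }
  unfold Rdiv at 1; rewrite (Rmult_comm _ (/ kappa)).
  apply is_derive_scal, (is_derive_minus p); [apply hp|].
  apply is_derive_cubic_comp, hv.
Qed.

(* With [q = v'' / v'] and [F] the cubic, [v''' / v' = (q - F'(v)) / kappa]
   and [kappa q' = q - F'(v) - kappa q^2]. *)
Lemma heteroclinic_third_derive_barrier (v p : R -> R) (e M : R) :
  heteroclinic v p ->
  (forall x, e * (((p x - cubic (v x)) / kappa / p x) ^ 2 + 6 * v x * p x) <= e * M) ->
  forall x, e * (((p x - cubic (v x)) / kappa - (3 * v x ^ 2 - 3 * s ^ 2) * p x) / kappa)
            <= e * (M * p x).
Proof.
  intros h hM x.
  set (A := fun t => (p t - cubic (v t)) / kappa) in *.
  set (dF := fun t => 3 * v t ^ 2 - 3 * s ^ 2).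
  set (T := fun t => (A t - dF t * p t) / kappa).
  set (q := fun t => A t / p t).
  assert (hp := fun t => heteroclinic_derive_pos v p t h).
  assert (hA : forall t, is_derive A t (T t)) by (intros t; apply is_derive_second, h).
  assert (hq : forall t, is_derive q t ((T t * p t - A t * A t) / p t ^ 2)).
  { intros t; apply is_derive_div; [apply hA | apply h |].
    apply Rgt_not_eq, hp. }
  assert (hdF : forall t, is_derive dF t (6 * v t * p t)).
  { intros t; unfold dF; auto_derive; [now exists (p t); apply h|].
    replace (Derive (fun x0 : R => v x0) t) with (p t); [ring|].
    symmetry; apply is_derive_unique, h. }
  (* The sign [e], later 1 or -1, treats both bounds at once. Up to the factor [p / kappa] this
     quantity is [e (M v' - v''')]. *)
  assert (hd : 0 <= e * (M * kappa - (q x - dF x))).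
  { apply (nonneg_of_backward_gronwall (fun t => e * (M * kappa - (q t - dF t)))
      (fun t => e * (0 - ((T t * p t - A t * A t) / p t ^ 2 - 6 * v t * p t)))
      kappa x (Rabs e * (Rabs M * kappa + 30 * s ^ 2))); [exact hkappa | | |].
    - intros t _; apply is_derive_scal, (is_derive_minus (fun _ => M * kappa)).
      + apply (is_derive_const (V := R_NormedModule)).
      + apply (is_derive_minus q); [apply hq | apply hdF].
    - intros t _.
      assert (h1 : kappa * (e * (0 - ((T t * p t - A t * A t) / p t ^ 2 - 6 * v t * p t)))
                   = e * (dF t - q t) + kappa * (e * (q t ^ 2 + 6 * v t * p t))).
      { unfold T, q; field; split; [apply Rgt_not_eq, hp | lra]. }
      rewrite h1; specialize (hM t).
      assert (h2 := Rmult_le_compat_l kappa _ _ (Rlt_le _ _ hkappa) hM).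
      change (kappa * (e * (q t ^ 2 + 6 * v t * p t)) <= kappa * (e * M)) in h2; lra.
    (* This barrier is bounded at every point: [q] and [F'] have moduli at most [18 s^2] and
       [9 s^2], whose sum is below [30 s^2]. *)
    - intros X; exists X; split; [lra|].
      assert (h1 := heteroclinic_log_derive_bounds v p X h).
      assert (h2 := derive_cubic_bound (v X) (heteroclinic_range v p X h)).
      fold (A X) in h1; fold (q X) in h1; fold (dF X) in h2.
      enough (Rabs (e * (M * kappa - (q X - dF X))) <= Rabs e * (Rabs M * kappa + 30 * s ^ 2))
        as h3 by (apply Rabs_le_between in h3; lra).
      rewrite Rabs_mult; apply Rmult_le_compat_l; [apply Rabs_pos|].
      unfold Rminus; eapply Rle_trans; [apply Rabs_triang|].
      rewrite Rabs_mult, (Rabs_pos_eq kappa) by lra.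
      apply Rplus_le_compat_l, Rabs_le; nra. }
  assert (hq2 : e * (M * p x) - e * T x = e * (M * kappa - (q x - dF x)) * (p x / kappa)).
  { unfold T, q; field; split; [lra | apply Rgt_not_eq, hp]. }
  assert (h1 : 0 <= e * (M * p x) - e * T x).
  { rewrite hq2; apply Rmult_le_pos; [exact hd|].
    left; apply Rdiv_lt_0_compat; [apply hp | exact hkappa]. }
  change (e * T x <= e * (M * p x)); lra.
Qed.

(** For [v <= 0] the term [6 v p] is nonpositive and [q^2 <= (18 s^2)^2]. For [v > 0] concavity
    gives [-3 s^2 <= q <= 0] and [p <= F(v) <= 3 s^3], so the sum is at most [27 s^4]. *)
Lemma heteroclinic_third_derive_le (v p : R -> R) (x : R) :
  heteroclinic v p ->
  ((p x - cubic (v x)) / kappa - (3 * v x ^ 2 - 3 * s ^ 2) * p x) / kappa <= 324 * s ^ 4 * p x.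
Proof.
  intros h; rewrite <- (Rmult_1_l (_ / kappa)), <- (Rmult_1_l (324 * s ^ 4 * p x)).
  apply (heteroclinic_third_derive_barrier v p 1 _ h); clear x; intros x; rewrite !Rmult_1_l.
  assert (hp := heteroclinic_derive_pos v p x h).
  assert (hr := heteroclinic_range v p x h).
  assert (hq := heteroclinic_log_derive_bounds v p x h).
  destruct (Rle_dec (v x) 0) as [hv | hv].
  - assert (v x * p x <= 0) by nra.
    assert (((p x - cubic (v x)) / kappa / p x) ^ 2 <= (18 * s ^ 2) ^ 2) by nra.
    nra.
  - assert (hF := heteroclinic_le_cubic v p x h ltac:(lra)).
    assert (hq0 : (p x - cubic (v x)) / kappa / p x <= 0).
    { apply (Rle_div_l _ _ _ hp), (Rle_div_l _ _ _ hkappa); lra. }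
    assert (((p x - cubic (v x)) / kappa / p x) ^ 2 <= (3 * s ^ 2) ^ 2) by nra.
    assert (hF3 : cubic (v x) <= 3 * s ^ 3).
    { unfold cubic; apply Rle_trans with (s ^ 2 * (3 * s)); [|lra].
      apply Rmult_le_compat; nra. }
    assert (v x * p x <= s * (3 * s ^ 3)) by (apply Rmult_le_compat; lra).
    assert (0 < s ^ 4) by (apply pow_lt; exact hs).
    nra.
Qed.

Lemma heteroclinic_third_derive_ge (v p : R -> R) (x : R) :
  heteroclinic v p ->
  - 60 * s ^ 4 * p x <= ((p x - cubic (v x)) / kappa - (3 * v x ^ 2 - 3 * s ^ 2) * p x) / kappa.
Proof.
  intros h.
  enough (- 1 * (((p x - cubic (v x)) / kappa - (3 * v x ^ 2 - 3 * s ^ 2) * p x) / kappa)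
          <= - 1 * (- 60 * s ^ 4 * p x)) by lra.
  apply (heteroclinic_third_derive_barrier v p (- 1) _ h); clear x; intros x.
  assert (hp := heteroclinic_derive_pos v p x h).
  assert (hr := heteroclinic_range v p x h).
  assert (hq := pow2_ge_0 ((p x - cubic (v x)) / kappa / p x)).
  enough (- 60 * s ^ 4 <= 6 * v x * p x) by lra.
  destruct (Rle_dec 0 (v x)) as [hv | hv].
  - assert (0 < s ^ 4) by (apply pow_lt; exact hs).
    assert (0 <= v x * p x) by (apply Rmult_le_pos; lra).
    lra.
  - assert (hF := heteroclinic_le_twice_cubic v p x h).
    apply Rle_trans with (6 * v x * (2 * cubic (v x))); [|nra].
    set (w := v x).
    (* A sum-of-squares certificate: [15 / 8] and [4 / 3] approximate [w^2 / s^2] and [- w / s] at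
       the minimizer [w = - (1 + sqrt 3) s / 2] of [w F(w)]. *)
    assert (heq : 6 * w * (2 * cubic w) + 60 * s ^ 4
      = 12 * ((w ^ 2 - 15 / 8 * s ^ 2) ^ 2
              + s ^ 2 * (3 / 4 * (w + 4 / 3 * s) ^ 2 + (95 / 64 - 4 / 3) * s ^ 2))).
    { unfold cubic; field. }
    assert (0 <= s ^ 2) by apply pow2_ge_0.
    assert (0 <= (w + 4 / 3 * s) ^ 2) by apply pow2_ge_0.
    assert (0 <= (w ^ 2 - 15 / 8 * s ^ 2) ^ 2) by apply pow2_ge_0.
    assert (0 <= s ^ 2 * (3 / 4 * (w + 4 / 3 * s) ^ 2 + (95 / 64 - 4 / 3) * s ^ 2)).
    { apply Rmult_le_pos; lra. }
    lra.
Qed.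

(** * Decay rates at both ends *)

(** For [t <= 0] one has [-2s <= v <= 0], so [(v - s)^2] lies between [s^2] and [9 s^2] and [v'] is
    comparable to [v + 2s]; Gronwall is applied from [x] to 0 on both sides. *)
Lemma heteroclinic_left_decay (v p : R -> R) (c x : R) :
  heteroclinic v p -> v 0 = 0 -> 0 < c -> (forall t, c * cubic (v t) <= p t) -> x < 0 ->
  2 * s * exp (- 18 * s ^ 2 * Rabs x) <= v x + 2 * s <= 2 * s * exp (- c * s ^ 2 * Rabs x).
Proof.
  intros h h0 hc hlow hx; rewrite (Rabs_left x hx).
  assert (hvneg : forall t, t <= 0 -> v t <= 0).
  { intros t [ht | ->]; [|lra].
    assert (h' := heteroclinic_increasing v p h t 0 ht); lra. }
  assert (hz : forall t, is_derive (fun t => v t + 2 * s) t (p t)).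
  { intros t; apply is_derive_add_const, h. }
  assert (hg1 : v 0 + 2 * s <= (v x + 2 * s) * exp (18 * s ^ 2 * (0 - x))).
  { apply (gronwall (fun t => v t + 2 * s) p); [lra | intros; apply hz |].
    intros t ht; apply Rle_trans with (1 := heteroclinic_le_twice_cubic v p t h).
    assert (hr := heteroclinic_range v p t h); unfold cubic.
    assert ((v t - s) ^ 2 <= 9 * s ^ 2) by nra.
    nra. }
  assert (hg2 : - (v 0 + 2 * s) <= - (v x + 2 * s) * exp (c * s ^ 2 * (0 - x))).
  { apply (gronwall (fun t => - (v t + 2 * s)) (fun t => - p t)); [lra | |].
    - intros t _; apply (is_derive_opp (fun t => v t + 2 * s)), hz.
    - intros t ht; specialize (hlow t); specialize (hvneg t ltac:(lra)).
      assert (hr := heteroclinic_range v p t h).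
      enough (c * s ^ 2 * (v t + 2 * s) <= c * cubic (v t)) by lra.
      unfold cubic; rewrite Rmult_assoc; apply Rmult_le_compat_l; [lra|].
      apply Rmult_le_compat_r; nra. }
  rewrite h0, Rplus_0_l in hg1, hg2.
  split.
  - apply Rmult_le_reg_r with (exp (18 * s ^ 2 * (0 - x))); [apply exp_pos|].
    rewrite (Rmult_assoc (2 * s)), <- exp_plus.
    replace (- 18 * s ^ 2 * - x + 18 * s ^ 2 * (0 - x)) with 0 by ring.
    rewrite exp_0; lra.
  - apply Rmult_le_reg_r with (exp (c * s ^ 2 * (0 - x))); [apply exp_pos|].
    rewrite (Rmult_assoc (2 * s)), <- exp_plus.
    replace (- c * s ^ 2 * - x + c * s ^ 2 * (0 - x)) with 0 by ring.
    rewrite exp_0; lra.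
Qed.

(** The reciprocal of [s - v] has derivative [p / (s - v)^2], between [2 c s] and [6 s] because
    [2s <= v + 2s <= 3s]; its linear growth is the algebraic decay. *)
Lemma heteroclinic_right_decay (v p : R -> R) (c x : R) :
  heteroclinic v p -> v 0 = 0 -> 0 < c -> (forall t, c * cubic (v t) <= p t) -> 0 < x ->
  s / (1 + 6 * s ^ 2 * Rabs x) <= s - v x <= s / (1 + 2 * c * s ^ 2 * Rabs x).
Proof.
  intros h h0 hc hlow hx; rewrite (Rabs_pos_eq x) by lra.
  assert (hw : forall t, 0 < s - v t).
  { intros t; assert (h' := heteroclinic_lt_right v p t h); lra. }
  assert (hvpos : forall t, 0 <= t -> 0 <= v t).
  { intros t [ht | <-]; [|lra].
    assert (h' := heteroclinic_increasing v p h 0 t ht); lra. }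
  assert (hinv : forall t, is_derive (fun t => / (s - v t)) t (p t / (s - v t) ^ 2)).
  { intros t; specialize (hw t).
    auto_derive; [split; [now exists (p t); apply h | lra]|].
    replace (Derive (fun x0 : R => v x0) t) with (p t); [field; lra|].
    symmetry; apply is_derive_unique, h. }
  assert (hub : / (s - v x) - / (s - v 0) <= 6 * s * (x - 0)).
  { apply (derive_le_bound (fun t => / (s - v t)) (fun t => p t / (s - v t) ^ 2));
      [lra | intros; apply hinv |].
    intros t ht; apply (Rle_div_l _ _ ((s - v t) ^ 2)); [apply pow_lt, hw|].
    apply Rle_trans with (1 := heteroclinic_le_twice_cubic v p t h); unfold cubic.
    specialize (hw t); assert (0 <= (s - v t) ^ 2) by apply pow2_ge_0; nra. }
  assert (hlb : - / (s - v x) - - / (s - v 0) <= - (2 * c * s) * (x - 0)).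
  { apply (derive_le_bound (fun t => - / (s - v t)) (fun t => - (p t / (s - v t) ^ 2)));
      [lra | |].
    - intros t _; apply (is_derive_opp (fun t => / (s - v t))), hinv.
    - intros t ht; apply Ropp_le_contravar.
      apply (Rle_div_r (2 * c * s) _ ((s - v t) ^ 2)); [apply pow_lt, hw|].
      apply Rle_trans with (2 := hlow t); unfold cubic.
      specialize (hvpos t ltac:(lra)).
      replace (2 * c * s * (s - v t) ^ 2) with (c * ((v t - s) ^ 2 * (2 * s))) by ring.
      apply Rmult_le_compat_l; [lra|]; apply Rmult_le_compat_l; [apply pow2_ge_0 | lra]. }
  rewrite h0, Rminus_0_r in hub, hlb; rewrite Rminus_0_r in hub, hlb.
  specialize (hw x).
  assert (heq : s * (s - v x) * / (s - v x) = s) by (field; lra).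
  assert (his : s * / s = 1) by (field; lra).
  assert (hsw : 0 < s * (s - v x)) by (apply Rmult_lt_0_compat; assumption).
  split.
  - apply (Rle_div_l s _ (1 + 6 * s ^ 2 * x)); [nra|].
    assert (h1 : s * (s - v x) * / (s - v x) <= s * (s - v x) * (/ s + 6 * s * x)).
    { apply Rmult_le_compat_l; lra. }
    replace (s * (s - v x) * (/ s + 6 * s * x))
      with ((s - v x) * (s * / s + 6 * s ^ 2 * x)) in h1 by ring.
    rewrite heq, his in h1; exact h1.
  - assert (0 < 2 * c * s ^ 2 * x).
    { apply Rmult_lt_0_compat; [|exact hx]; apply Rmult_lt_0_compat; [lra | now apply pow_lt]. }
    apply (Rle_div_r _ s (1 + 2 * c * s ^ 2 * x)); [lra|].
    assert (h1 : s * (s - v x) * (/ s + 2 * c * s * x) <= s * (s - v x) * / (s - v x)).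
    { apply Rmult_le_compat_l; lra. }
    replace (s * (s - v x) * (/ s + 2 * c * s * x))
      with ((s - v x) * (s * / s + 2 * c * s ^ 2 * x)) in h1 by ring.
    rewrite heq, his in h1; exact h1.
Qed.

Lemma heteroclinic_left_derive_decay (v p : R -> R) (c x : R) :
  heteroclinic v p -> v 0 = 0 -> 0 < c -> (forall t, c * cubic (v t) <= p t) -> x < 0 ->
  2 * c * s ^ 3 * exp (- 18 * s ^ 2 * Rabs x) <= p x
  <= 36 * s ^ 3 * exp (- c * s ^ 2 * Rabs x).
Proof.
  intros h h0 hc hlow hx.
  assert (hd := heteroclinic_left_decay v p c x h h0 hc hlow hx).
  assert (hup := heteroclinic_le_twice_cubic v p x h); specialize (hlow x).
  assert (hr := heteroclinic_range v p x h).
  assert (hv := heteroclinic_increasing v p h x 0 hx); rewrite h0 in hv.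
  set (e1 := exp (- 18 * s ^ 2 * Rabs x)) in *; set (e2 := exp (- c * s ^ 2 * Rabs x)) in *.
  unfold cubic in *.
  assert (hsq : s ^ 2 <= (v x - s) ^ 2 <= 9 * s ^ 2) by nra.
  assert (he1 : 0 < e1) by apply exp_pos.
  split.
  - apply Rle_trans with (2 := hlow).
    replace (2 * c * s ^ 3 * e1) with (c * (s ^ 2 * (2 * s * e1))) by ring.
    apply Rmult_le_compat_l; [lra|].
    apply Rmult_le_compat; try lra; apply Rmult_le_pos; lra.
  - apply Rle_trans with (1 := hup).
    replace (36 * s ^ 3 * e2) with (2 * (9 * s ^ 2 * (2 * s * e2))) by ring.
    apply Rmult_le_compat_l; [lra|].
    apply Rmult_le_compat; try lra; apply pow2_ge_0.
Qed.

Lemma heteroclinic_right_derive_decay (v p : R -> R) (c x : R) :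
  heteroclinic v p -> v 0 = 0 -> 0 < c -> (forall t, c * cubic (v t) <= p t) -> 0 < x ->
  2 * c * s ^ 3 / (1 + 6 * s ^ 2 * Rabs x) ^ 2 <= p x
  <= 6 * s ^ 3 / (1 + 2 * c * s ^ 2 * Rabs x) ^ 2.
Proof.
  intros h h0 hc hlow hx.
  assert (hd := heteroclinic_right_decay v p c x h h0 hc hlow hx).
  assert (hup := heteroclinic_le_twice_cubic v p x h); specialize (hlow x).
  assert (hr := heteroclinic_range v p x h).
  assert (hv := heteroclinic_increasing v p h 0 x hx); rewrite h0 in hv.
  assert (ha : 0 < Rabs x) by (apply Rabs_pos_lt; lra).
  assert (hs2 : 0 < s ^ 2 * Rabs x) by (apply Rmult_lt_0_compat; [apply pow_lt|]; assumption).
  assert (hk1 : 0 < 1 + 6 * s ^ 2 * Rabs x) by lra.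
  assert (hk2 : 0 < 1 + 2 * c * s ^ 2 * Rabs x) by nra.
  set (k1 := 1 + 6 * s ^ 2 * Rabs x) in *; set (k2 := 1 + 2 * c * s ^ 2 * Rabs x) in *.
  assert (hk1' : 0 < s / k1) by (apply Rdiv_lt_0_compat; lra).
  assert (hsq1 : (s / k1) ^ 2 <= (s - v x) ^ 2) by (apply pow_incr; lra).
  assert (hsq2 : (s - v x) ^ 2 <= (s / k2) ^ 2) by (apply pow_incr; lra).
  unfold cubic in *; replace ((v x - s) ^ 2) with ((s - v x) ^ 2) in * by ring.
  split.
  - apply Rle_trans with (2 := hlow).
    replace (2 * c * s ^ 3 / k1 ^ 2) with (c * ((s / k1) ^ 2 * (2 * s))) by (field; lra).
    apply Rmult_le_compat_l; [lra|].
    apply Rmult_le_compat; try lra; apply pow2_ge_0.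
  - apply Rle_trans with (1 := hup).
    replace (6 * s ^ 3 / k2 ^ 2) with (2 * ((s / k2) ^ 2 * (3 * s))) by (field; lra).
    apply Rmult_le_compat_l; [lra|].
    apply Rmult_le_compat; try lra; apply pow2_ge_0.
Qed.

(** * Existence and uniqueness *)

(** Negative arguments, at which [sqrt] is 0, are included: the energy equation is solved before the
    sign of its solution is known. *)
Lemma sqrt_modulus (a b e : R) : 0 <= e -> Rabs (a - b) <= e ^ 2 -> Rabs (sqrt a - sqrt b) <= e.
Proof.
  assert (h : forall a b e, 0 <= e -> a - b <= e ^ 2 -> sqrt a - sqrt b <= e).
  { clear; intros a b e he hab.
    assert (hb := sqrt_pos b).
    enough (sqrt a <= sqrt b + e) by lra.
    rewrite <- (sqrt_pow2 (sqrt b + e)) by lra.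
    apply sqrt_le_1_alt.
    destruct (Rle_dec 0 b) as [hb0 | hb0].
    - assert (hd := sqrt_def b hb0); nra.
    - nra. }
  intros he hab; apply Rabs_le_between in hab.
  assert (h1 := h a b e he ltac:(lra)); assert (h2 := h b a e he ltac:(lra)).
  apply Rabs_le; lra.
Qed.

(* As a function of [x = s - v], the kinetic energy [y = v'^2 / 2] solves an
   equation whose right-hand side is decreasing in [y], although not Lipschitz
   at [y = 0]. *)
Lemma energy_exists :
  exists y : R -> R, y 0 = 0 /\
    forall x, 0 <= x <= 3 * s -> is_derive y x ((cubic (s - x) - sqrt (2 * y x)) / kappa).
Proof.
  destruct (monotone_ode_solution (fun x => cubic (s - x) / kappa)
              (fun a => sqrt (2 * a) / kappa) (3 * s)) as [y [hy0 hy]].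
  - lra.
  - intros x; apply (is_derive_continuous _ x (- (3 * (s - x) ^ 2 - 3 * s ^ 2) / kappa)).
    unfold cubic; auto_derive; [easy | field; lra].
  - intros a; apply Rle_mult_inv_pos; [apply sqrt_pos | exact hkappa].
  - intros a b hab; apply Rmult_le_compat_r; [left; now apply Rinv_0_lt_compat|].
    apply sqrt_le_1_alt; lra.
  - intros eps heps; assert (hke : 0 < kappa * eps) by now apply Rmult_lt_0_compat.
    exists ((kappa * eps) ^ 2 / 2); split.
    { apply Rdiv_lt_0_compat; [now apply pow_lt | lra]. }
    intros a b hab.
    replace (_ - _) with ((sqrt (2 * a) - sqrt (2 * b)) / kappa) by (field; lra).
    unfold Rdiv; rewrite Rabs_mult, (Rabs_pos_eq (/ kappa)) by (left; now apply Rinv_0_lt_compat).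
    apply (Rle_div_l _ _ kappa hkappa); rewrite (Rmult_comm eps).
    apply sqrt_modulus; [lra|].
    replace (2 * a - 2 * b) with (2 * (a - b)) by ring.
    rewrite Rabs_mult, (Rabs_pos_eq 2) by lra; lra.
  - exists y; split; [exact hy0|]; intros x hx.
    replace ((cubic (s - x) - sqrt (2 * y x)) / kappa)
      with (cubic (s - x) / kappa - sqrt (2 * y x) / kappa) by (field; lra).
    now apply hy.
Qed.

(* [P w] is the speed [v'] of a profile at height [v = w]. *)
Definition speed (P : R -> R) : Prop :=
  forall w, - 2 * s < w < s ->
    0 < P w <= 2 * cubic w /\ is_derive P w ((P w - cubic w) / (kappa * P w)).

(** [P w] is [sqrt (2 y (s - w))]. Strict positivity of the energy [y] is needed to differentiate
    the root, and [y <= 2 F^2] is the bound [P <= 2 F]. *)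
Lemma speed_exists : exists P, speed P.
Proof.
  destruct energy_exists as [y [hy0 hy]].
  set (dy := fun x => (cubic (s - x) - sqrt (2 * y x)) / kappa) in *.
  assert (hcub : forall x, 0 <= x <= 3 * s -> 0 <= cubic (s - x)).
  { intros x hx; apply cubic_nonneg; lra. }
  assert (hcub0 : forall x, 0 < x < 3 * s -> 0 < cubic (s - x)).
  { intros x hx; apply Rmult_lt_0_compat; [apply pow2_gt_0|]; lra. }
  assert (hnn : forall x, 0 <= x <= 3 * s -> 0 <= y x).
  { intros x hx; enough (- y x <= 0) by lra.
    apply (nonpos_of_derive_nonpos (fun x => - y x) (fun x => - dy x) 0); [lra | | | rewrite hy0; lra].
    - intros t ht; apply (is_derive_opp y), hy; lra.
    - intros t ht hpos; unfold dy; rewrite sqrt_neg_0 by lra.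
      specialize (hcub t ltac:(lra)).
      assert (0 <= (cubic (s - t) - 0) / kappa) by (apply Rle_mult_inv_pos; lra).
      lra. }
  assert (hpos : forall x, 0 < x < 3 * s -> 0 < y x).
  (* At an interior zero the slope would be [F / kappa > 0], making [y] negative just to the
     left. *)
  { intros x hx; destruct (hnn x ltac:(lra)) as [h | h]; [exact h | exfalso].
    assert (hd : is_derive y x (dy x)) by (apply hy; lra).
    assert (hdx : dy x = cubic (s - x) / kappa).
    { unfold dy; rewrite <- h, Rmult_0_r, sqrt_0; field; lra. }
    assert (hdpos : 0 < dy x) by (rewrite hdx; apply Rdiv_lt_0_compat; auto).
    apply is_derive_Reals in hd.
    destruct (hd (dy x) hdpos) as [r hr].
    assert (hr0 := cond_pos r).
    set (k := Rmin (r / 2) x).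
    assert (hk : 0 < k /\ k <= r / 2 /\ k <= x).
    { split; [apply Rmin_pos; lra | split; [apply Rmin_l | apply Rmin_r]]. }
    specialize (hr (- k) ltac:(lra)).
    rewrite Rabs_Ropp, Rabs_pos_eq in hr by lra; specialize (hr ltac:(lra)).
    apply Rabs_def2 in hr.
    specialize (hnn (x + - k) ltac:(lra)).
    assert (hq : 0 < (y (x + - k) - y x) / - k) by lra.
    apply (Rmult_lt_compat_r k) in hq; [|lra].
    replace ((y (x + - k) - y x) / - k * k) with (y x - y (x + - k)) in hq by (field; lra).
    lra. }
  assert (hub : forall x, 0 <= x <= 3 * s -> y x <= 2 * cubic (s - x) ^ 2).
  (* Where the bound fails, [sqrt (2 y) >= 2 F], so [kappa] times the derivative is at most
     [F - 2 F + 4 F * (1 / 4) = 0]. *)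
  { intros x hx; enough (y x - 2 * cubic (s - x) ^ 2 <= 0) by lra.
    apply (nonpos_of_derive_nonpos (fun x => y x - 2 * cubic (s - x) ^ 2)
      (fun x => dy x - 4 * cubic (s - x) * - (3 * (s - x) ^ 2 - 3 * s ^ 2)) 0); [lra | | |].
    - intros t ht; apply (is_derive_minus y); [apply hy; lra|].
      unfold cubic; auto_derive; [easy | ring].
    - intros t ht hgt; specialize (hcub t ltac:(lra)).
      assert (hsq : 2 * cubic (s - t) <= sqrt (2 * y t)).
      { rewrite <- (sqrt_pow2 (2 * cubic (s - t))) by lra; apply sqrt_le_1_alt; lra. }
      assert (hdc := derive_cubic_bound (s - t) ltac:(lra)).
      apply Rmult_le_reg_l with kappa; [assumption|].
      unfold dy.
      replace (kappa * _) with (cubic (s - t) - sqrt (2 * y t)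
        + 4 * cubic (s - t) * (kappa * (3 * (s - t) ^ 2 - 3 * s ^ 2))) by (field; lra).
      assert (hkd : kappa * (3 * (s - t) ^ 2 - 3 * s ^ 2) <= 1 / 4) by nra.
      assert (4 * cubic (s - t) * (kappa * (3 * (s - t) ^ 2 - 3 * s ^ 2)) <= 4 * cubic (s - t) * (1 / 4)).
      { apply Rmult_le_compat_l; lra. }
      lra.
    - rewrite hy0; assert (0 <= cubic (s - 0) ^ 2) by apply pow2_ge_0; lra. }
  exists (fun w => sqrt (2 * y (s - w))); intros w hw.
  assert (hyw := hpos (s - w) ltac:(lra)).
  assert (hP : 0 < sqrt (2 * y (s - w))) by (apply sqrt_lt_R0; lra).
  assert (hc : cubic (s - (s - w)) = cubic w) by (f_equal; ring).
  split; [split; [exact hP|]|].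
  - assert (h := hub (s - w) ltac:(lra)); rewrite hc in h.
    assert (h0 := hcub (s - w) ltac:(lra)); rewrite hc in h0.
    rewrite <- (sqrt_pow2 (2 * cubic w)) by lra; apply sqrt_le_1_alt; lra.
  - assert (hd := hy (s - w) ltac:(lra)).
    rewrite hc in hd.
    replace ((_ - _) / _) with ((2 * (- 1 * ((cubic w - sqrt (2 * y (s - w))) / kappa)))
                                / (2 * sqrt (2 * y (s - w)))) by (field; lra).
    apply (is_derive_sqrt (fun w => 2 * y (s - w))); [|lra].
    apply is_derive_scal, (is_derive_comp y (fun w => s - w)); [exact hd|].
    auto_derive; [easy | ring].
Qed.

Lemma heteroclinic_follows_speed (v p P : R -> R) (x : R) :
  heteroclinic v p -> speed P -> p x = P (v x).
Proof.
  intros h hP.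
  assert (hr : forall t, - 2 * s < v t < s).
  { intros t; split; [now apply (heteroclinic_gt_left v p) | now apply (heteroclinic_lt_right v p)]. }
  set (D := fun t => p t - P (v t)).
  assert (hD : forall t, is_derive D t (cubic (v t) / (kappa * P (v t)) * D t)).
  { intros t; destruct (hP (v t) (hr t)) as [[hpos _] hd].
    replace (_ * _) with ((p t - cubic (v t)) / kappa
                          - p t * ((P (v t) - cubic (v t)) / (kappa * P (v t)))).
    - apply (is_derive_minus p); [apply h|].
      apply (is_derive_comp P v); [exact hd | apply h].
    - unfold D; field; split; lra. }
  (* [D] solves a linear equation with nonnegative coefficient, so [D^2] is nondecreasing; it tends
     to 0 because [p] and [P (v t)] both lie between 0 and [2 F(v)]. *)
  assert (hle : D x ^ 2 <= 0).
  { apply (le_limit_of_nondecreasing (fun t => D t ^ 2)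
             (fun t => INR 2 * (cubic (v t) / (kappa * P (v t)) * D t) * D t ^ 1)).
    - intros t _; apply is_derive_pow, hD.
    - intros t _; destruct (hP (v t) (hr t)) as [[hpos _] _].
      assert (h1 : 0 <= cubic (v t) / (kappa * P (v t))).
      { apply Rle_mult_inv_pos; [left; now apply (heteroclinic_cubic_pos v p)|].
        now apply Rmult_lt_0_compat. }
      assert (h2 := pow2_ge_0 (D t)); simpl in h2 |- *; nra.
    - apply (is_lim_le_le_loc (fun _ => 0) (fun t => (2 * cubic (v t)) ^ 2)).
      + exists 0; intros t _; split; [apply pow2_ge_0|].
        destruct (hP (v t) (hr t)) as [hb _].
        assert (h1 := heteroclinic_le_twice_cubic v p t h).
        assert (h2 := heteroclinic_derive_pos v p t h).
        unfold D; nra.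
      + apply is_lim_const.
      + replace (Finite 0) with (Finite ((2 * cubic s) ^ 2))
          by (unfold cubic; f_equal; ring).
        apply (is_lim_comp_continuous v (fun w => (2 * cubic w) ^ 2)); [apply h|].
        apply (ex_derive_continuous (fun w => (2 * cubic w) ^ 2)).
        unfold cubic; auto_derive; easy. }
  assert (h0 : D x = 0) by nra.
  unfold D in h0; lra.
Qed.

(** * Logistic coordinate and travel time *)

(** The factor 2 gives [logistic 0 = 0], from which the normalization [u 0 = 0] follows. *)
Definition logistic (t : R) : R := s - 3 * s / (1 + 2 * exp t).

Lemma logistic_range (t : R) : - 2 * s < logistic t < s.
Proof.
  assert (he := exp_pos t); unfold logistic.
  assert (0 < 3 * s / (1 + 2 * exp t)) by (apply Rdiv_lt_0_compat; lra).
  assert (3 * s / (1 + 2 * exp t) < 3 * s); [|lra].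
  apply (Rlt_div_l _ _ (1 + 2 * exp t)); nra.
Qed.

Lemma is_derive_logistic (t : R) :
  is_derive logistic t ((s - logistic t) * (logistic t + 2 * s) / (3 * s)).
Proof.
  assert (he := exp_pos t).
  unfold logistic; auto_derive; [lra | field; lra].
Qed.

Lemma logistic_surjective (w : R) :
  - 2 * s < w < s -> logistic (ln ((w + 2 * s) / (2 * (s - w)))) = w.
Proof.
  intros hw; unfold logistic; rewrite exp_ln; [field; lra | apply Rdiv_lt_0_compat; lra].
Qed.

(* [Phi w] is the time needed to reach height [w], and [u] is its inverse; the
   logistic function unfolds (-2s, s) onto the line. *)
Lemma travel_time_exists (P : R -> R) : speed P ->
  exists Phi u : R -> R,
    (forall w, - 2 * s < w < s -> is_derive Phi w (/ P w) /\ u (Phi w) = w) /\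
    (forall t, - 2 * s < u t < s /\ is_derive u t (P (u t))) /\ u 0 = 0.
Proof.
  intros hP.
  set (dl := fun t => (s - logistic t) * (logistic t + 2 * s) / (3 * s)).
  set (z := fun t => dl t / P (logistic t)).
  assert (hdl : forall t, 0 < dl t).
  { intros t; assert (h := logistic_range t).
    apply Rdiv_lt_0_compat; [apply Rmult_lt_0_compat|]; lra. }
  assert (hzc : forall t, continuous z t).
  { intros t; destruct (hP (logistic t) (logistic_range t)) as [[hpos _] hd].
    assert (hl := is_derive_logistic t).
    apply (ex_derive_continuous z); unfold z, dl; auto_derive.
    assert (hex : ex_derive logistic t) by (eexists; exact hl).
    repeat split; try exact hex; [eexists; exact hd | lra]. }
  (* [z] is the travel-time density in the logistic coordinate. Since [P <= 2 F <= 18 s^2 dl], it is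
     bounded below, so reaching either end state takes infinite time. *)
  assert (hz : forall t, / (18 * s ^ 2) <= z t).
  { intros t; destruct (hP (logistic t) (logistic_range t)) as [[hpos hub] _].
    assert (hr := logistic_range t).
    assert (hs2 : 0 < 18 * s ^ 2) by (apply Rmult_lt_0_compat; [lra | now apply pow_lt]).
    apply (Rle_div_r _ _ _ hpos), (Rmult_le_reg_l (18 * s ^ 2)); [exact hs2|].
    rewrite <- Rmult_assoc, Rinv_r, Rmult_1_l by lra.
    apply Rle_trans with (1 := hub); unfold cubic, dl.
    set (w := logistic t) in *.
    replace (18 * s ^ 2 * ((s - w) * (w + 2 * s) / (3 * s)))
      with (2 * ((s - w) * (3 * s) * (w + 2 * s))) by (field; lra).
    apply Rmult_le_compat_l; [lra|]; apply Rmult_le_compat_r; nra. }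
  set (Z := fun t => RInt z 0 t).
  assert (hZ : forall t, is_derive Z t (z t)).
  { intros t; apply is_derive_RInt_continuous, hzc. }
  destruct (inverse_of_expanding Z z (/ (18 * s ^ 2))) as [Y [hYZ [hZY hY]]];
    [| exact hZ | exact hz |].
  { apply Rinv_0_lt_compat, Rmult_lt_0_compat; [lra | now apply pow_lt]. }
  set (ell := fun w => ln ((w + 2 * s) / (2 * (s - w)))).
  exists (fun w => Z (ell w)), (fun t => logistic (Y t)).
  split; [|split].
  - intros w hw; split; [|rewrite hYZ; now apply logistic_surjective].
    destruct (hP w hw) as [[hpos _] _].
    replace (/ P w) with (3 * s / ((s - w) * (w + 2 * s)) * z (ell w)).
    + apply (is_derive_comp Z ell); [apply hZ|].
      unfold ell; auto_derive.
      * repeat split; try lra; apply Rdiv_lt_0_compat; lra.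
      * field; lra.
    + unfold z, dl, ell; rewrite (logistic_surjective w hw); field; lra.
  - intros t; split; [apply logistic_range|].
    destruct (hP (logistic (Y t)) (logistic_range (Y t))) as [[hpos _] _].
    replace (P (logistic (Y t))) with (/ z (Y t) * dl (Y t)).
    + apply (is_derive_comp logistic Y); [apply is_derive_logistic | apply hY].
    + unfold z; field; split; [lra | apply Rgt_not_eq, hdl].
  - replace 0 with (Z 0) by apply (RInt_point (V := R_CompleteNormedModule)).
    rewrite hYZ; replace (Z 0) with 0 by (symmetry; apply (RInt_point (V := R_CompleteNormedModule))).
    unfold logistic; rewrite exp_0; field.
Qed.

(** The limits hold because [u] is monotone and attains every height [w] of (-2s, s), at time
    [Phi w]. *)
Lemma heteroclinic_exists (P u : R -> R) (Phi : R -> R) :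
  speed P -> (forall w, - 2 * s < w < s -> u (Phi w) = w) ->
  (forall t, - 2 * s < u t < s /\ is_derive u t (P (u t))) ->
  heteroclinic u (fun t => P (u t)).
Proof.
  intros hP hPhi hu.
  assert (hmono : forall a b, a <= b -> u a <= u b).
  { intros a b hab.
    assert (h : - u b - - u a <= 0 * (b - a)); [|lra].
    apply (derive_le_bound (fun t => - u t) (fun t => - P (u t))); [exact hab | |].
    - intros t _; apply (is_derive_opp u), hu.
    - intros t _; destruct (hP (u t) (proj1 (hu t))) as [hpos _]; lra. }
  split; [intros t; apply hu|]; split; [|split].
  - intros t; destruct (hu t) as [hr hd], (hP (u t) hr) as [[hpos _] hdP].
    replace (_ / _) with (P (u t) * ((P (u t) - cubic (u t)) / (kappa * P (u t))))
      by (field; lra).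
    now apply (is_derive_comp P u).
  - apply is_lim_spec; intros eps; assert (heps := cond_pos eps).
    set (w := Rmin (- 2 * s + eps / 2) 0).
    assert (hw : - 2 * s < w < s /\ w <= - 2 * s + eps / 2).
    { split; [split|]; [apply Rmin_glb_lt; lra | | apply Rmin_l].
      apply Rle_lt_trans with 0; [apply Rmin_r | exact hs]. }
    exists (Phi w); intros t ht.
    assert (h := hmono t (Phi w) ltac:(lra)); rewrite hPhi in h by apply hw.
    destruct (hu t) as [hr _]; apply Rabs_def1; lra.
  - apply is_lim_spec; intros eps; assert (heps := cond_pos eps).
    set (w := Rmax (s - eps / 2) 0).
    assert (hw : - 2 * s < w < s /\ s - eps / 2 <= w).
    { split; [split|]; [| apply Rmax_lub_lt; lra | apply Rmax_l].
      apply Rlt_le_trans with 0; [lra | apply Rmax_r]. }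
    exists (Phi w); intros t ht.
    assert (h := hmono (Phi w) t ltac:(lra)); rewrite hPhi in h by apply hw.
    destruct (hu t) as [hr _]; apply Rabs_def1; lra.
Qed.

Lemma heteroclinic_unique_up_to_translation (P Phi u v p : R -> R) :
  speed P ->
  (forall w, - 2 * s < w < s -> is_derive Phi w (/ P w) /\ u (Phi w) = w) ->
  heteroclinic v p -> exists h, forall x, v x = u (x + h).
Proof.
  intros hP hPhi h.
  assert (hr : forall t, - 2 * s < v t < s).
  { intros t; split; [now apply (heteroclinic_gt_left v p) | now apply (heteroclinic_lt_right v p)]. }
  assert (hconst : forall t, is_derive (fun t => Phi (v t) - t) t 0).
  { intros t; destruct (hP (v t) (hr t)) as [[hpos _] _].
    replace 0 with (p t * / P (v t) - 1).
    - apply (is_derive_minus (fun t => Phi (v t))); [|apply (is_derive_id (K := R_AbsRing))].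
      apply (is_derive_comp Phi v); [apply hPhi, hr | apply h].
    - rewrite (heteroclinic_follows_speed v p P t h hP); field; lra. }
  exists (Phi (v 0)); intros x.
  assert (hx := constant_of_derive_zero _ hconst x 0).
  replace (x + Phi (v 0)) with (Phi (v x)) by lra.
  symmetry; apply hPhi, hr.
Qed.

(* Polynomials in [v] and [v'] are stable under differentiation along orbits. *)
Inductive orbit_polynomial (v p : R -> R) : (R -> R) -> Prop :=
| orbit_const c : orbit_polynomial v p (fun _ => c)
| orbit_position : orbit_polynomial v p v
| orbit_momentum : orbit_polynomial v p p
| orbit_add f g : orbit_polynomial v p f -> orbit_polynomial v p g ->
    orbit_polynomial v p (fun x => f x + g x)
| orbit_mul f g : orbit_polynomial v p f -> orbit_polynomial v p g ->
    orbit_polynomial v p (fun x => f x * g x).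

Lemma orbit_polynomial_derive (v p f : R -> R) :
  heteroclinic v p -> orbit_polynomial v p f ->
  exists g, orbit_polynomial v p g /\ forall x, is_derive f x (g x).
Proof.
  intros h hf.
  induction hf as [c | | | f1 f2 h1 [g1 [hg1 hd1]] h2 [g2 [hg2 hd2]]
                  | f1 f2 h1 [g1 [hg1 hd1]] h2 [g2 [hg2 hd2]]].
  - exists (fun _ => 0); split; [constructor|].
    intros x; apply (is_derive_const (V := R_NormedModule)).
  - exists p; split; [constructor | apply h].
  - exists (fun x => / kappa * (p x + - 1 * ((v x + - s) * (v x + - s) * (v x + 2 * s)))).
    split; [repeat constructor|].
    intros x; replace (_ * _) with ((p x - cubic (v x)) / kappa); [apply h|].
    unfold cubic; field; lra.
  - exists (fun x => g1 x + g2 x); split; [now constructor|].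
    intros x; now apply (is_derive_plus f1 f2).
  - exists (fun x => g1 x * f2 x + f1 x * g2 x); split; [repeat constructor; assumption|].
    intros x; apply (is_derive_mult f1 f2); [apply hd1 | apply hd2 | apply Rmult_comm].
Qed.

Lemma heteroclinic_smooth (v p : R -> R) : heteroclinic v p -> smooth v.
Proof.
  intros h.
  assert (hn : forall n, exists g, orbit_polynomial v p g /\ forall x, Derive_n v n x = g x).
  { intros n; induction n as [|n [g [hg heq]]].
    - exists v; split; [constructor | reflexivity].
    - destruct (orbit_polynomial_derive v p g h hg) as [g' [hg' hd]].
      exists g'; split; [exact hg'|]; intros x; simpl.
      rewrite (Derive_ext _ g x heq); apply is_derive_unique, hd. }
  (* At order 0, [ex_derive_n] is [True]. *)
  intros [|n] x; [exact I|].
  destruct (hn n) as [g [hg heq]], (orbit_polynomial_derive v p g h hg) as [g' [_ hd]].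
  exists (g' x); apply (is_derive_ext g); [intros t; symmetry; apply heq | apply hd].
Qed.

(** * Return from the planar system to the profile equation *)

Lemma heteroclinic_Derive (v p : R -> R) (x : R) : heteroclinic v p -> Derive v x = p x.
Proof. intros h; apply is_derive_unique, h. Qed.

Lemma heteroclinic_Derive_2 (v p : R -> R) (x : R) :
  heteroclinic v p -> Derive_n v 2 x = (p x - cubic (v x)) / kappa.
Proof.
  intros h; simpl; rewrite (Derive_ext _ p).
  - apply is_derive_unique, h.
  - intros t; now apply heteroclinic_Derive.
Qed.

Lemma heteroclinic_Derive_3 (v p : R -> R) (x : R) :
  heteroclinic v p ->
  Derive_n v 3 x = ((p x - cubic (v x)) / kappa - (3 * v x ^ 2 - 3 * s ^ 2) * p x) / kappa.
Proof.
  intros h; change (Derive (Derive_n v 2) x = ((p x - cubic (v x)) / kappa - (3 * v x ^ 2 - 3 * s ^ 2) * p x) / kappa).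
  rewrite (Derive_ext _ (fun t => (p t - cubic (v t)) / kappa)).
  - apply is_derive_unique, is_derive_second, h.
  - intros t; now apply heteroclinic_Derive_2.
Qed.

Lemma heteroclinic_wave_profile (v p : R -> R) :
  heteroclinic v p -> wave_profile kappa (3 * s ^ 2) (- 2 * s) s v.
Proof.
  intros h; split; [intros k x _; now apply (heteroclinic_smooth v p)|].
  split; [|split; apply h].
  intros x.
  rewrite (heteroclinic_Derive v p x h), (heteroclinic_Derive_2 v p x h),
    (heteroclinic_Derive_3 v p x h).
  rewrite (is_derive_unique _ _ _ (is_derive_pow v 3 x (p x) (proj1 h x))).
  simpl; field; lra.
Qed.

End Profile.

Theorem theorem2p1 (s kappa : R)
    (hs : 0 < s) (hkappa : 0 < kappa) (hks : 36 * kappa * s ^ 2 <= 1) :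
  let sigma := 3 * s ^ 2 in
  let c := 4 * sqrt 3 - 6 in
  exists u : R -> R,
    smooth u /\
    strict_increasing u /\
    wave_profile kappa sigma (- 2 * s) s u /\
    (forall v : R -> R,
       wave_profile kappa sigma (- 2 * s) s v ->
       exists h : R, forall xi : R, v xi = u (xi + h)) /\
    u 0 = 0 /\
    (forall xi : R,
       c * (u xi - s) ^ 2 * (u xi + 2 * s) <= Derive u xi
       <= 2 * (u xi - s) ^ 2 * (u xi + 2 * s)) /\
    (forall xi : R, xi < 0 ->
       2 * s * exp (- 18 * s ^ 2 * Rabs xi) <= u xi + 2 * s
       <= 2 * s * exp (- c * s ^ 2 * Rabs xi)) /\
    (forall xi : R, 0 < xi ->
       s / (1 + 6 * s ^ 2 * Rabs xi) <= s - u xi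
       <= s / (1 + 2 * c * s ^ 2 * Rabs xi)) /\
    (forall xi : R, xi < 0 ->
       2 * c * s ^ 3 * exp (- 18 * s ^ 2 * Rabs xi) <= Derive u xi
       <= 36 * s ^ 3 * exp (- c * s ^ 2 * Rabs xi)) /\
    (forall xi : R, 0 < xi ->
       2 * c * s ^ 3 / (1 + 6 * s ^ 2 * Rabs xi) ^ 2 <= Derive u xi
       <= 6 * s ^ 3 / (1 + 2 * c * s ^ 2 * Rabs xi) ^ 2) /\
    (forall xi : R,
       - 3 * s ^ 2 * Derive u xi <= Derive_n u 2 xi
       <= 18 * s ^ 2 * Derive u xi) /\
    (forall xi : R,
       - 60 * s ^ 4 * Derive u xi <= Derive_n u 3 xi
       <= 324 * s ^ 4 * Derive u xi) /\
    (forall xi : R, Rabs (Derive_n u 2 xi) <= 18 * s ^ 2 * Derive u xi) /\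
    (forall xi : R, Rabs (Derive_n u 3 xi) <= 324 * s ^ 4 * Derive u xi).

Proof.
  intros sigma c.
  destruct (speed_exists s kappa hs hkappa hks) as [P hP].
  destruct (travel_time_exists s kappa hs P hP) as [Phi [u [hPhi [hu hu0]]]].
  set (p := fun t => P (u t)).
  assert (h : heteroclinic s kappa u p).
  { apply (heteroclinic_exists s kappa hs hkappa P u Phi hP); [intros; now apply hPhi | exact hu]. }
  assert (hc : 0 < c < 1) by apply rate_bounds.
  assert (hlow : forall t, c * cubic s (u t) <= p t).
  { intros t; now apply (heteroclinic_ge_rate_cubic s kappa hs hkappa hks). }
  assert (hpos := fun x => heteroclinic_derive_pos s kappa hs hkappa hks u p x h).
  assert (hD := fun x => heteroclinic_Derive s kappa u p x h).
  assert (h2 : forall x, - 3 * s ^ 2 * p x <= Derive_n u 2 x <= 18 * s ^ 2 * p x).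
  { intros x; rewrite (heteroclinic_Derive_2 s kappa u p x h).
    split; [exact (heteroclinic_second_derive_ge s kappa hs hkappa hks u p x h) | exact (heteroclinic_second_derive_le s kappa hs hkappa hks u p x h)]. }
  assert (h3 : forall x, - 60 * s ^ 4 * p x <= Derive_n u 3 x <= 324 * s ^ 4 * p x).
  { intros x; rewrite (heteroclinic_Derive_3 s kappa u p x h).
    split; [exact (heteroclinic_third_derive_ge s kappa hs hkappa hks u p x h) | exact (heteroclinic_third_derive_le s kappa hs hkappa hks u p x h)]. }
  assert (hs2 : forall x, 0 < s ^ 2 * p x).
  { intros x; apply Rmult_lt_0_compat; [now apply pow_lt | apply hpos]. }
  assert (hs4 : forall x, 0 < s ^ 4 * p x).
  { intros x; apply Rmult_lt_0_compat; [now apply pow_lt | apply hpos]. }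
  exists u.
  split; [now apply (heteroclinic_smooth s kappa hkappa u p)|].
  split; [now apply (heteroclinic_increasing s kappa hs hkappa hks u p)|].
  split; [now apply (heteroclinic_wave_profile s kappa hkappa u p)|].
  split.
  { intros v hv.
    apply (heteroclinic_unique_up_to_translation s kappa hs hkappa hks P Phi u v (Derive v) hP hPhi).
    now apply wave_profile_heteroclinic. }
  split; [exact hu0|].
  split.
  { intros x; rewrite hD, !Rmult_assoc; split; [apply hlow|].
    now apply (heteroclinic_le_twice_cubic s kappa hs hkappa hks u p). }
  split; [intros x hx; now apply (heteroclinic_left_decay s kappa hs hkappa hks u p)|].
  split; [intros x hx; now apply (heteroclinic_right_decay s kappa hs hkappa hks u p)|].
  split.
  { intros x hx; rewrite hD; now apply (heteroclinic_left_derive_decay s kappa hs hkappa hks u p). }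
  split.
  { intros x hx; rewrite hD; now apply (heteroclinic_right_derive_decay s kappa hs hkappa hks u p). }
  split; [intros x; rewrite hD; apply h2|].
  split; [intros x; rewrite hD; apply h3|].
  (* The lower constants 3 and 60 are below the upper ones 18 and 324, and [s^2 v'], [s^4 v'] are
     positive. *)
  split; intros x; rewrite hD; apply Rabs_le.
  - specialize (h2 x); specialize (hs2 x); lra.
  - specialize (h3 x); specialize (hs4 x); lra.
Qed.
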